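(* Let $k \geq 2$, $g \geq 1$ and $n$ be positive integers, and let $A \subseteq \{1,2,\dots,n\}$ be a $B_k[g]$ set. \begin{itemize} \item[(i)] If $g = 1$, then \[ |A| \leq \left( \left\lceil\frac{k}{2}\right\rceil !\,\left\lfloor\frac{k}{2}\right\rfloor !\,\sqrt{\frac{\pi k}{2}}\,\bigl(1+ O(k^{-1/3})\bigr)\,n\right)^{1/k}. \] \item[(ii)] If $g > 1$, then \[ |A| \leq \left(\sqrt{\frac{\pi k}{2}}\; k!\, g\,\bigl(1+ O(k^{-1/3})\bigr)\,n\right)^{1/k}. \] \end{itemize} Here $O(k^{-1/3})$ denotes a quantity whose absolute value is at most $Ck^{-1/3}$ for a constant $C$ not depending on $n$ or on $A$.
   Context: A set $A \subseteq \mathbb{Z}$ is a $B_k[g]$ set if for every integer $m$ there are at most $g$ multisets $\{x_1,\dots,x_k\}$ of size $k$ with all $x_i \in A$ and $x_1+\cdots+x_k = m$. A $B_k[1]$ set is also called a $B_k$ set. *)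

(* Defs.v *)
From mathcomp Require Export all_boot all_order all_algebra.
From mathcomp Require Export finmap multiset.
From mathcomp Require Export all_classical all_reals all_analysis.
Export Order.TTheory GRing.Theory Num.Theory.

Set Implicit Arguments.
Unset Strict Implicit.
Unset Printing Implicit Defensive.

Local Open Scope classical_set_scope.
Local Open Scope mset_scope.
Local Open Scope card_scope.
Local Open Scope ring_scope.

(* The multisets {x_1, ..., x_k} of elements of A with x_1 + ... + x_k = m;
   a multiset coerces to the list of its elements with repetitions. *)
Definition ksum_msets (k : nat) (A : set int) (m : int) : set {mset int} :=
  [set X : {mset int} | [/\ size X = k,
                            forall x, x \in X -> A x
                          & \sum_(x <- X) x = m]].

Definition is_Bkg (k g : nat) (A : set int) : Prop :=
  forall m : int, ksum_msets k A m #<= `I_g.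

(* Main.v *)
(**
Let [X_1, ..., X_k] be independent and uniform on [A].  Their sum has variance at
most [k n^2 / 4], so by Gaussian behaviour some value is taken with probability
about [1 / (n * sqrt (pi k / 2))] or more, whereas the [B_k[g]] property bounds
every probability by [k! g / |A|^k].  To make this quantitative one tests the law
against the nonnegative trigonometric polynomial [|sum_j tent_j e^{i j x}|^2] with
about [k^{2/3}] frequencies: in that range the characteristic function has a
positive real part, and the Fourier weights of the polynomial are [1 - O(d^2 / k^{4/3})],
which is where the error [k^{-1/3}] comes from.

For [g = 1] one uses differences of [ceil(k/2)] and [floor(k/2)] terms.  Such a
difference determines the two multisets only when these are disjoint.  This is
enforced by a random splitting of [A] in two halves from which the two groups of
terms are drawn; averaging over the splittings, a pair of disjoint multisets with
multiplicities [m_x] receives the weight [prod 2^(m_x - 1) / m_x!], at most 1, so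
nothing is lost.  This works once [|A|] is of order [k^{11/8}].  For smaller [A], the
multisets containing an element three times on each side have weight noticeably
smaller than 1, and this gain exceeds the factor [sqrt k] lost by counting the
possible values trivially; when [8 |A| < k] the factorials alone suffice.
*)

Require Import Defs.
From mathcomp Require Import all_boot all_order all_algebra.
From mathcomp Require Import finmap multiset.
From mathcomp Require Import all_classical all_reals all_analysis.
From mathcomp Require Import zify ring lra.
Import Order.TTheory GRing.Theory Num.Theory.
Import numFieldNormedType.Exports.

Set Implicit Arguments.
Unset Strict Implicit.
Unset Printing Implicit Defensive.

Local Open Scope classical_set_scope.
Local Open Scope fset_scope.
Local Open Scope ring_scope.

(** * Elementary inequalities and Gaussian sums *)

Section ElementaryInequalities.
Context {R : realType}.
Implicit Types x y z : R.

(** Why $k^{2/3}$ frequencies: the elements are centred at their mean, so at frequency $\tau/n$ the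
    average of the exponentials has imaginary part only $O(\tau^3)$. Its $k$-th power turns by about
    $k\tau^3$, and the real part stays positive while $\tau$ is a small multiple of $k^{-1/3}$; the
    grid of frequencies has step $2\pi/(kn)$. Why a tent: the frequencies that matter have index
    about $\sqrt k$. Sharply cut coefficients would give weights $1 - O(d/k^{2/3})$ and an error
    $k^{-1/6}$; Lipschitz coefficients that vanish at the ends make the loss quadratic. Why
    $k^{11/8}$: prescribing two triples costs $|A|^4$, while the factorials gain $k^6$, the trivial
    count of values loses $k$, and $\sqrt k$ is available. This works up to $|A|^4$ of order
    $k^{11/2}$. On the other side, a splitting is unbalanced beyond relative order $k^{-2/3}$ with
    probability $\exp(-c|A|k^{-4/3})$. For $|A|$ above $k^{11/8}$ the exponent has order at least
    $k^{1/24}$, and the inverse of its eighth power is $k^{-1/3}$. *)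

Lemma sin_ub y : 0 <= y -> `|sin y| <= y.
Proof.
move=> y0; have [c _] := @MVT_segment R sin cos 0 y y0
  (fun x _ => is_derive_sin x) (continuous_subspaceT (@continuous_sin R)).
rewrite sin0 !subr0 => ->; rewrite normrM (ger0_norm y0).
by rewrite ler_piMl// cos_max.
Qed.

Lemma norm_sin_le y : `|sin y| <= `|y|.
Proof.
have [y0|/ltW y0] := leP 0 y; first by rewrite (ger0_norm y0) sin_ub.
rewrite -(opprK y) sinN normrN normrN (ger0_norm (_ : 0 <= - y)) ?oppr_ge0//.
by rewrite sin_ub ?oppr_ge0.
Qed.

Lemma cos_ge_sqr y : 1 - y ^+ 2 / 2 <= cos y.
Proof.
have -> : cos y = 1 - 2 * sin (y / 2) ^+ 2.
  have {1}-> : y = (y / 2) *+ 2 by rewrite mulr2n; lra.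
  by rewrite cos_mulr2n cos2sin2 mulr2n; ring.
have : sin (y / 2) ^+ 2 <= (y / 2) ^+ 2.
  rewrite -(real_normK (num_real (sin _))) -(real_normK (num_real (y / 2))).
  by rewrite lerXn2r ?nnegrE ?norm_sin_le.
by rewrite expr_div_n; lra.
Qed.

(** Only the cubic order is used: it is the whole phase error once the linear term has been removed
    by centring. *)
Lemma sin_sub_le y : `|sin y - y| <= `|y| ^+ 3.
Proof.
wlog y0 : y / 0 <= y => [hw|].
  have [y0|/ltW y0] := leP 0 y; first exact: hw.
  have := hw (- y); rewrite oppr_ge0 sinN normrN => /(_ y0).
  by rewrite -opprB opprK normrN addrC.
have D x : x \in `]0, y[ -> is_derive x 1 (fun u : R => sin u - u) (cos x - 1).
  by move=> _; apply: is_deriveB.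
have cf : {within `[0, y], continuous (fun u : R => sin u - u)}.
  apply: continuous_subspaceT => u; apply: continuousB; [exact: continuous_sin|exact: cvg_id].
have [c] := @MVT_segment R (fun u : R => sin u - u) (fun u => cos u - 1) 0 y y0 D cf.
rewrite in_itv/= => /andP[c0 cy].
rewrite sin0 !subr0 => ->; rewrite normrM (ger0_norm y0) exprSr ler_wpM2r//.
have h1 := cos_ge_sqr c; have h2 := cos_le1 c.
rewrite ler0_norm ?subr_le0// opprB.
have : c ^+ 2 <= y ^+ 2 by rewrite lerXn2r ?nnegrE.
have := sqr_ge0 y; nra.
Qed.

Lemma expR_gt_inv x : x < 1 -> expR x <= (1 - x)^-1.
Proof.
move=> x1; rewrite -[leLHS]invrK -expRN lef_pV2 ?posrE ?expR_gt0 ?subr_gt0//.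
exact: expR_ge1Dx.
Qed.

(** The first-order term is exact because this bound gets raised to the power [k]; it comes from
    $\log(1-z) \ge -z/(1-z)$. *)
Lemma one_sub_ge_expR z : 0 <= z <= 2^-1 -> expR (- (z + 2 * z ^+ 2)) <= 1 - z.
Proof.
move=> /andP[z0 z1]; have z1' : 0 < 1 - z by lra.
apply: (@le_trans _ _ (expR (- (z / (1 - z))))).
  rewrite ler_expR lerN2 ler_pdivrMr//.
  have : 0 <= z * (z - 2 * z ^+ 2) by apply: mulr_ge0 => //; nra.
  by nra.
rewrite expRN -[leRHS]invrK lef_pV2 ?posrE ?expR_gt0 ?invr_gt0//.
have e : (1 - z)^-1 = 1 + z / (1 - z) by field; rewrite gt_eqF.
by apply: le_trans (expR_ge1Dx _); rewrite le_eqVlt {1}e eqxx.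
Qed.

Lemma one_sub_ge_expR2 z : 0 <= z <= 2^-1 -> expR (- (2 * z)) <= 1 - z.
Proof.
move=> /andP[z0 z1]; apply: le_trans (one_sub_ge_expR _); last by rewrite z0.
by rewrite ler_expR lerN2; nra.
Qed.

(** Subgaussian bound for one random sign. The constant 2 instead of 1/2 only affects numerical
    constants in the tails. *)
Lemma cosh_le x : (expR x + expR (- x)) / 2 <= expR (2 * x ^+ 2).
Proof.
wlog x0 : x / 0 <= x => [hw|].
  have [x0|/ltW x0] := leP 0 x; first exact: hw.
  by have := hw (- x); rewrite oppr_ge0 opprK sqrrN addrC => /(_ x0).
have [x1|/ltW x1] := leP x 2^-1; last first.
  have h : expR x <= expR (2 * x ^+ 2) by rewrite ler_expR; nra.
  have : expR (- x) <= expR x by rewrite ler_expR; lra.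
  lra.
have a1 : expR x <= 1 + x + 2 * x ^+ 2.
  apply: le_trans (expR_gt_inv _) _; first lra.
  rewrite -[_^-1]mul1r ler_pdivrMr ?subr_gt0; last lra.
  have : 0 <= x ^+ 2 * (1 - 2 * x) by apply: mulr_ge0; [exact: sqr_ge0|lra].
  lra.
have a2 : expR (- x) <= 1 - x + 2 * x ^+ 2.
  apply: le_trans (expR_gt_inv _) _; first lra.
  rewrite opprK -[_^-1]mul1r ler_pdivrMr; last lra.
  have : 0 <= x ^+ 2 * (1 + 2 * x) by apply: mulr_ge0; [exact: sqr_ge0|lra].
  lra.
have := expR_ge1Dx (2 * x ^+ 2); lra.
Qed.

End ElementaryInequalities.

(** * Gaussian sums compared with the Gaussian integral *)

Section GaussianSum.
Context {R : realType}.
Import gauss_integral_proof.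
Local Notation G := (@integral0_gauss R).

Lemma derive_integral0_gauss (x : R) : 0 < x ->
  is_derive x 1 G (gauss_fun x).
Proof.
move=> x0.
have [d e] : derivable G x 1 /\ derive1 G x = gauss_fun x.
  apply: (@continuous_FTC1 R gauss_fun (BLeft 0) _ (x + 1) _ _ _ _).
  - by rewrite ltrDl.
  - apply: continuous_compact_integrable => //; first exact: segment_compact.
    by apply: continuous_subspaceT; exact: continuous_gauss_fun.
  - by rewrite /=; rewrite lte_fin.
  - by move=> ?; exact: continuous_gauss_fun.
have e' : 'D_1 G x = gauss_fun x by rewrite -derive1E.
exact: DeriveDef d e'.
Qed.

Lemma continuous_integral0_gauss (a b : R) : 0 <= a -> 0 <= b ->
  {within `[a, b], continuous G}.
Proof.
move=> a0 b0; apply: (@continuous_subspaceW _ _ _ `[0, b]).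
  by apply: subset_itvr; rewrite bnd_simp.
apply: parameterized_integral_continuous => //=.
apply: continuous_compact_integrable => //; first exact: segment_compact.
by apply: continuous_subspaceT; exact: continuous_gauss_fun.
Qed.

Lemma integral0_gauss_incr (a b : R) : 0 <= a -> a <= b ->
  G b - G a <= (b - a) * expR (- a ^+ 2).
Proof.
move=> a0 ab; have b0 := le_trans a0 ab.
have D x : x \in `]a, b[ -> is_derive x 1 G (gauss_fun x).
  rewrite in_itv/= => /andP[ax _]; apply: derive_integral0_gauss.
  exact: le_lt_trans a0 ax.
have [c] := MVT_segment ab D (continuous_integral0_gauss a0 b0).
rewrite in_itv/= => /andP[ac cb] ->.
rewrite mulrC ler_wpM2l ?subr_ge0// /gauss_fun ler_expR lerN2.
by rewrite lerXn2r ?nnegrE// (le_trans a0).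
Qed.

(** Beyond 1 the integrand is at most $e^{-x}$, so [G x + expR (- x)] does not increase there. *)
Lemma integral0_gauss_tail (a b : R) : 1 <= a -> a <= b ->
  G b - G a <= expR (- a).
Proof.
move=> a1 ab; have a0 : 0 <= a by rewrite (le_trans _ a1).
have b0 := le_trans a0 ab.
pose F (x : R) := G x + expR (- x).
have D x : x \in `]a, b[ -> is_derive x 1 F (gauss_fun x - expR (- x)).
  rewrite in_itv/= => /andP[ax _].
  have := derive_integral0_gauss (le_lt_trans a0 ax) => d.
  apply: is_deriveD.
  have dN : is_derive x (1 : R) (fun y : R => - y) (- 1) by apply: is_deriveN.
  have := @is_derive1_comp R expR (fun y : R => - y) x (expR (- x)) (- 1) (is_derive_expR _) dN.
  by rewrite mulrN1.
have cF : {within `[a, b], continuous F}.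
  move=> x; apply: continuousD; first exact: (continuous_integral0_gauss a0 b0).
  apply: (@continuous_subspaceT _ _ _ (fun y : R => expR (- y))) => y.
  apply: continuous_comp; first exact: opp_continuous.
  exact: continuous_expR.
have [c] := MVT_segment ab D cF.
rewrite in_itv/= => /andP[ac cb] e.
have : F b - F a <= 0.
  rewrite e mulr_le0_ge0 ?subr_ge0// subr_le0 /gauss_fun ler_expR lerN2.
  have := le_trans a1 ac; nra.
by rewrite /F; have := expR_gt0 (- b); lra.
Qed.

Lemma integral0_gauss_lb (a : R) : 1 <= a ->
  Num.sqrt pi / 2 - expR (- a) <= G a.
Proof.
move=> a1; have a0 : 0 <= a by rewrite (le_trans _ a1).
set s := G a + expR (- a).
have s0 : 0 <= s by rewrite addr_ge0 ?expR_ge0// integral0_gauss_ge0.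
suff h : pi / 4 <= s ^+ 2.
  rewrite lerBlDr -/s -(@ler_pXn2r _ 2) ?nnegrE//.
  by rewrite exprMn sqr_sqrtr ?pi_ge0// (le_trans _ h)//; have := @pi_ge0 R; lra.
apply: (@closed_cvg _ _ _ _ _ (fun v => v <= s ^+ 2) _ _ _ (@cvg_integral0_gauss_sqr R)); [exact: closed_le|].
near=> y.
have ay : a <= y by near: y; apply: nbhs_pinfty_ge; rewrite num_real.
rewrite lerXn2r ?nnegrE ?integral0_gauss_ge0// /s.
by have := integral0_gauss_tail a1 ay; lra.
Unshelve. all: end_near. Qed.

(** A left Riemann sum of a decreasing function dominates its integral. *)
Lemma sum_expR_sqr_ge (c : R) (D : nat) : 0 < c -> 1 <= D%:R * c ->
  Num.sqrt pi / 2 - expR (- (D%:R * c)) <=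
    c * \sum_(0 <= d < D) expR (- (c * d%:R) ^+ 2).
Proof.
move=> c0 Dc; apply: le_trans (integral0_gauss_lb Dc) _.
have: G (D%:R * c) - G (0%:R * c) <= c * \sum_(0 <= d < D) expR (- (c * d%:R) ^+ 2).
  rewrite -(@telescope_sumr _ 0 D (fun d => G (d%:R * c)))// mulr_sumr.
  apply: ler_sum => d _.
  apply: le_trans (integral0_gauss_incr _ _) _.
  - by rewrite mulr_ge0// ltW.
  - by rewrite ler_wpM2r ?ler_nat// ltW.
  - by rewrite -mulrBl -natr1 [_ + 1]addrC addrK mul1r [d%:R * c]mulrC.
by rewrite mul0r [G 0]/integral0_gauss set_itv1 Rintegral_set1 subr0.
Qed.

End GaussianSum.

(** * A nonnegative kernel *)

Section Kernel.
Context {R : realType}.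

(** Multiplication by [2 * sin h], with [h] half the step, makes the sum telescope, and the two end
    points differ by [d] full turns. The condition on [d] makes [sin h] positive. *)
Lemma sum_cos_arith (M d : nat) (s : R) : (0 < d < M)%N ->
  \sum_(0 <= i < M) cos (d%:R * (2 * pi / M%:R) * (i%:R + s)) = 0.
Proof.
move=> /andP[d0 dM].
have M0 : (0 : R) < M%:R by rewrite ltr0n (ltn_trans d0).
set h : R := pi * (d%:R / M%:R).
have sh : 0 < sin h.
  apply: sin_gt0_pi; rewrite /h mulr_gt0 ?pi_gt0 ?divr_gt0 ?ltr0n ?(ltn_trans d0 dM)//=.
  by rewrite -ltr_pdivlMl ?pi_gt0// mulVf ?gt_eqF ?pi_gt0// ltr_pdivrMr// mul1r ltr_nat.
have sh2 : 2 * sin h != 0 by rewrite gt_eqF// mulr_gt0.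
apply: (mulfI sh2).
rewrite mulr0 mulr_sumr.
pose T (i : nat) := sin (2 * h * (i%:R + s) - h).
rewrite (eq_bigr (fun i => T i.+1 - T i)); last first.
  move=> i _; rewrite /T -[i.+1%:R]natr1.
  have -> : 2 * h * (i%:R + 1 + s) - h = 2 * h * (i%:R + s) + h by ring.
  have -> : d%:R * (2 * pi / M%:R) * (i%:R + s) = 2 * h * (i%:R + s).
    by rewrite /h; ring.
  by rewrite sinB sinD; ring.
rewrite telescope_sumr// /T.
have -> : 2 * h * (M%:R + s) - h = 2 * h * (0%:R + s) - h + (pi *+ 2) *+ d.
  have hM : h * M%:R = pi * d%:R by rewrite /h -mulrA divfK ?gt_eqF.
  rewrite -[pi *+ 2]mulr_natr -[_ *+ d]mulr_natr.
  have -> : 2 * h * (M%:R + s) - h = 2 * h * s - h + 2 * (h * M%:R) by ring.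
  by rewrite hM add0r; ring.
by rewrite periodicn ?subrr//; exact: sinD2pi.
Qed.

Lemma double_sum_sym (F : nat -> nat -> R) (L : nat) :
  (forall i j, F i j = F j i) ->
  \sum_(0 <= i < L) \sum_(0 <= j < L) F i j =
  \sum_(0 <= j < L) (F j j + 2 * \sum_(0 <= i < j) F i j).
Proof.
move=> Fs; elim: L => [|L IH]; first by rewrite !big_nil.
rewrite [RHS]big_nat_recr//= -IH big_nat_recr//= [X in _ + X]big_nat_recr//=.
rewrite (eq_bigr (fun i => \sum_(0 <= j < L) F i j + F i L)); last first.
  by move=> i _; rewrite big_nat_recr.
rewrite big_split/= (eq_bigr (fun i => F i L) (F1 := F L)) => [|i _]; last exact: Fs.
by ring.
Qed.

(** The value at 0 is 0, so in the correlations below the truncated difference [j - d] contributes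
    nothing when [j < d]. *)
Definition tent (L j : nat) : nat := minn j (L - j).

Lemma tent_lip (L j d : nat) :
  ((tent L j)%:R - (tent L (j - d))%:R : R) ^+ 2 <= d%:R ^+ 2.
Proof.
have h : (tent L j <= tent L (j - d) + d /\ tent L (j - d) <= tent L j + d)%N.
  by rewrite /tent; lia.
have [] := h; rewrite -!(ler_nat R) !natrD => h1 h2.
by have : (0 : R) <= d%:R := ler0n _ _; nra.
Qed.

(** Polarisation, $2ab = a^2 + b^2 - (a-b)^2$: the squared differences are at most $d^2$ by the
    Lipschitz property, and the shift loses only the last [d] squares, each at most $d^2$. *)
Lemma tent_corr (J d : nat) (S := \sum_(0 <= j < J.*2) ((tent J.*2 j)%:R ^+ 2 : R)) :
  (d <= J.*2)%N ->
  S - J.*2%:R * d%:R ^+ 2 <=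
  \sum_(0 <= j < J.*2) (tent J.*2 (j - d))%:R * (tent J.*2 j)%:R.
Proof.
move=> dJ; set L := J.*2 in S dJ *.
have h : S + (S - d%:R * d%:R ^+ 2) - L%:R * d%:R ^+ 2 <=
   2 * \sum_(0 <= j < L) (tent L (j - d))%:R * (tent L j)%:R.
  have -> : 2 * \sum_(0 <= j < L) (tent L (j - d))%:R * (tent L j)%:R =
    S + \sum_(0 <= j < L) (tent L (j - d))%:R ^+ 2 -
    \sum_(0 <= j < L) ((tent L j)%:R - (tent L (j - d))%:R) ^+ 2 :> R.
    rewrite mulr_sumr -big_split/= -sumrB; apply: eq_bigr => j _; ring.
  apply: lerB; last first.
    apply: le_trans (ler_sum _ (fun j _ => tent_lip L j d)) _.
    by rewrite sumr_const_nat subn0 mulr_natl.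
  rewrite lerD2l.
  rewrite [leRHS](@big_cat_nat _ _ _ d)//= lerBlDl.
  rewrite /S (@big_cat_nat _ _ _ (L - d))//= ?leq_subr// addrC lerD//.
    apply: (@le_trans _ _ (\sum_(L - d <= j < L) d%:R ^+ 2)).
      apply: ler_sum_nat => j /andP[j1 j2].
      rewrite lerXn2r ?nnegrE// ler_nat /tent; lia.
    by rewrite sumr_const_nat subKn// mulr_natl.
  apply: (@le_trans _ _ (\sum_(d <= j < L) (tent L (j - d))%:R ^+ 2)).
    by rewrite -{2}[d]add0n big_addn; apply: ler_sum => i _; rewrite addnK.
  rewrite lerDr; apply: sumr_ge0 => i _; exact: sqr_ge0.
have dL : d%:R * d%:R ^+ 2 <= L%:R * d%:R ^+ 2 :> R.
  by rewrite ler_wpM2r ?sqr_ge0// ler_nat.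
lra.
Qed.

Lemma sum_sqr_ge (J : nat) : J%:R ^+ 3 / 3 <= \sum_(0 <= j < J.+1) (j%:R ^+ 2 : R).
Proof.
elim: J => [|J IH]; first by rewrite big_nat1 !expr0n/= mul0r.
rewrite big_nat_recr//= -natr1.
apply: le_trans (lerD IH (lexx _)).
suff h (j : R) : 0 <= j -> (j + 1) ^+ 3 / 3 <= j ^+ 3 / 3 + (j + 1) ^+ 2 by exact: h.
by move=> j0; nra.
Qed.

Lemma sum_tent_sqr (J : nat) : (0 < J)%N ->
  J%:R ^+ 3 / 3 <= \sum_(0 <= j < J.*2) ((tent J.*2 j)%:R ^+ 2 : R).
Proof.
move=> J0; apply: le_trans (sum_sqr_ge J) _.
rewrite [leRHS](@big_cat_nat _ _ _ J.+1)//=; last lia.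
rewrite -[leLHS]addr0 lerD//; last by apply: sumr_ge0 => i _; exact: sqr_ge0.
apply: ler_sum_nat => j /andP[_ j1].
by rewrite lerXn2r ?nnegrE// ler_nat /tent; lia.
Qed.

(* The trigonometric polynomial below is the square modulus of
   [\sum_j tent j * exp (i j x)], hence nonnegative. *)
Definition jackson (L : nat) (x : R) : R :=
  \sum_(0 <= i < L) \sum_(0 <= j < L)
    (tent L i)%:R * (tent L j)%:R * cos ((i%:R - j%:R) * x).

Lemma jackson_ge0 L x : 0 <= jackson L x.
Proof.
have -> : jackson L x = (\sum_(0 <= i < L) (tent L i)%:R * cos (i%:R * x)) ^+ 2
   + (\sum_(0 <= i < L) (tent L i)%:R * sin (i%:R * x)) ^+ 2.
  rewrite !expr2 !big_distrlr/= -big_split/=; apply: eq_bigr => i _.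
  rewrite -big_split/=; apply: eq_bigr => j _.
  by rewrite mulrBl cosB; ring.
by rewrite addr_ge0 ?sqr_ge0.
Qed.

Lemma jacksonE L x : jackson L x =
  \sum_(0 <= j < L) (tent L j)%:R ^+ 2 + 2 * \sum_(1 <= d < L)
   (\sum_(0 <= j < L) (tent L (j - d))%:R * (tent L j)%:R) * cos (d%:R * x).
Proof.
rewrite /jackson double_sum_sym; last first.
  by move=> i j; rewrite -opprB mulNr cosN [_ * (tent L j)%:R]mulrC.
rewrite big_split/=; congr (_ + _).
  by apply: eq_bigr => j _; rewrite subrr mul0r cos0 mulr1 expr2.
rewrite -mulr_sumr; congr (2 * _).
under [RHS]eq_bigr do rewrite mulr_suml.
rewrite exchange_big_nat/=; apply: eq_big_nat => j /andP[_ jL].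
case: j jL => [|j] jL.
  rewrite big_nil big1// => d _; rewrite sub0n.
  by rewrite /tent min0n !mul0r.
rewrite [RHS](@big_cat_nat _ _ _ j.+2)//=.
have -> : \sum_(j.+2 <= i < L)
    (tent L (j.+1 - i))%:R * (tent L j.+1)%:R * cos (i%:R * x) = 0.
  rewrite big_nat big1// => d /andP[d1 d2].
  have -> : (j.+1 - d = 0)%N by lia.
  by rewrite /tent min0n !mul0r.
rewrite addr0.
rewrite big_nat_rev big_add1/=; apply: eq_big_nat => i /andP[_ ij].
rewrite add0n subSS; congr (_ * _).
rewrite -cosN -mulNr opprB -natrB; last lia.
by congr (cos (_%:R * _)); lia.
Qed.

(** The kernel is summed against [r] over a full period of the grid. From above, [r i <= B] and
    nonnegativity leave only the constant coefficient [S], every other frequency having sum zero.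
    From below, the hypothesis on [r] is applied to each frequency; the terms with [d >= D] are
    nonnegative and are dropped. The width [c] merges the Gaussian decay [kap] with the loss of the
    Fourier weights. *)
Lemma jackson_kernel_bound (M J D : nat) (s B Q kap c : R) (r : nat -> R) :
  (0 < J)%N -> (J.*2 <= M)%N -> 0 <= Q -> 0 < c ->
  c ^+ 2 = kap + 12 / J%:R ^+ 2 -> (4 * D <= J)%N -> 1 <= D%:R * c ->
  (forall i, 0 <= r i <= B) ->
  (forall d, (d < J.*2)%N -> Q * expR (- (kap * d%:R ^+ 2)) <=
     \sum_(0 <= i < M) r i * cos (d%:R * (2 * pi / M%:R) * (i%:R + s))) ->
  Q * ((Num.sqrt pi - 2 * expR (- (D%:R * c))) / c - 1) <= B * M%:R.
Proof.
move=> J0 JM Q0 c0 cE DJ Dc rB rQ.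
set L := J.*2 in JM rQ.
set S := \sum_(0 <= j < L) ((tent L j)%:R ^+ 2 : R).
have S3 : J%:R ^+ 3 / 3 <= S by exact: sum_tent_sqr.
have J0' : (0 : R) < J%:R by rewrite ltr0n.
have S0 : 0 < S by apply: lt_le_trans S3; rewrite divr_gt0 ?exprn_gt0.
pose C d : R := \sum_(0 <= j < L) (tent L (j - d))%:R * (tent L j)%:R.
have C0 d : 0 <= C d by apply: sumr_ge0 => j _; rewrite mulr_ge0.
pose x (i : nat) : R := 2 * pi / M%:R * (i%:R + s).
have up : \sum_(0 <= i < M) r i * jackson L (x i) <= B * M%:R * S.
  apply: (@le_trans _ _ (\sum_(0 <= i < M) B * jackson L (x i))).
    apply: ler_sum => i _; rewrite ler_wpM2r ?jackson_ge0//.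
    by have /andP[] := rB i.
  rewrite -mulr_sumr (eq_bigr _ (fun i _ => jacksonE L (x i))) big_split/=.
  rewrite sumr_const_nat subn0 -mulr_sumr exchange_big_nat/=.
  rewrite [X in 2 * X](_ : _ = 0).
    by rewrite mulr0 addr0 -/S -[S *+ M]mulr_natl mulrA.
  rewrite big_nat big1// => d /andP[d1 d2].
  rewrite -mulr_sumr; have := @sum_cos_arith M d s.
  rewrite d1 (leq_trans d2 JM) => /(_ isT) e.
  rewrite [X in _ * X](_ : _ = 0) ?mulr0// -[RHS]e.
  by apply: eq_bigr => i _; rewrite /x mulrA.
have lo : Q * (S + 2 * \sum_(1 <= d < L) C d * expR (- (kap * d%:R ^+ 2))) <=
    \sum_(0 <= i < M) r i * jackson L (x i).
  have -> : \sum_(0 <= i < M) r i * jackson L (x i) =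
     S * (\sum_(0 <= i < M) r i * cos (0%:R * (2 * pi / M%:R) * (i%:R + s))) +
     2 * \sum_(1 <= d < L) C d *
       (\sum_(0 <= i < M) r i * cos (d%:R * (2 * pi / M%:R) * (i%:R + s))).
    under eq_bigr do rewrite jacksonE mulrDr.
    rewrite big_split/=; congr (_ + _).
      rewrite mulr_sumr; apply: eq_bigr => i _.
      by rewrite !mul0r cos0 mulr1 mulrC.
    rewrite mulr_sumr; under [RHS]eq_bigr do rewrite mulr_sumr mulr_sumr.
    rewrite exchange_big_nat/=; apply: eq_bigr => i _.
    rewrite mulrA mulr_sumr; apply: eq_bigr => d _.
    have -> : d%:R * (2 * pi / M%:R) * (i%:R + s) = d%:R * x i by rewrite /x [RHS]mulrA.
    by rewrite -/(C d); ring.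
  rewrite mulrDr; apply: lerD.
    rewrite mulrC ler_wpM2l// ?(ltW S0)//; have := rQ 0%N.
    by rewrite expr0n/= mulr0 oppr0 expR0 mulr1; apply; rewrite /L; lia.
  rewrite mulrCA ler_wpM2l// mulr_sumr; apply: ler_sum_nat => d /andP[d1 d2].
  by rewrite mulrCA ler_wpM2l// rQ.
(* The relative loss is at most [z], that is $2Jd^2/(J^3/3) = 6d^2/J^2$. The condition [4 * D <= J]
   keeps it below 1/2, and passing to an exponential doubles it, whence 12. *)
have corr d : (d < D)%N -> S * expR (- (12 / J%:R ^+ 2 * d%:R ^+ 2)) <= C d.
  move=> dD; apply: le_trans (@tent_corr J d _); last lia.
  rewrite -/L -/S; set z : R := 6 / J%:R ^+ 2 * d%:R ^+ 2.
  have z0 : 0 <= z by rewrite mulr_ge0 ?divr_ge0 ?sqr_ge0.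
  have z1 : z <= 2^-1.
    rewrite /z mulrAC ler_pdivrMr ?exprn_gt0//.
    have : 4 * d%:R <= J%:R :> R by rewrite -natrM ler_nat; lia.
    by have : (0 : R) <= d%:R := ler0n _ _; nra.
  have -> : 12 / J%:R ^+ 2 * d%:R ^+ 2 = 2 * z by rewrite /z; field; rewrite gt_eqF.
  apply: (@le_trans _ _ (S * (1 - z))).
    by rewrite ler_wpM2l ?(ltW S0)// one_sub_ge_expR2// z0.
  rewrite mulrBr mulr1 lerD2l lerN2 /z.
  have -> : L%:R = 2 * J%:R :> R by rewrite /L -mul2n natrM.
  have -> : 2 * J%:R * d%:R ^+ 2 = J%:R ^+ 3 / 3 * (6 / J%:R ^+ 2 * d%:R ^+ 2) :> R.
    by field; rewrite gt_eqF.
  by rewrite ler_wpM2r// /z.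
have main : S * (2 * \sum_(0 <= d < D) expR (- (c * d%:R) ^+ 2) - 1) <=
    S + 2 * \sum_(1 <= d < L) C d * expR (- (kap * d%:R ^+ 2)).
  have D0 : (0 < D)%N by case: (D) Dc => [|//]; rewrite mul0r; lra.
  have -> : \sum_(0 <= d < D) expR (- (c * d%:R) ^+ 2) =
      1 + \sum_(1 <= d < D) expR (- (c * d%:R) ^+ 2).
    by rewrite big_ltn// mulr0 expr0n/= oppr0 expR0.
  set t := \sum_(1 <= d < D) _.
  have -> : S * (2 * (1 + t) - 1) = S + 2 * (S * t) by ring.
  rewrite /t.
  rewrite lerD2l ler_wpM2l// [leRHS](@big_cat_nat _ _ _ D)//=; last by rewrite /L; lia.
  rewrite -[leLHS]addr0 lerD//; last first.
    by apply: sumr_ge0 => d _; rewrite mulr_ge0 ?expR_ge0.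
  rewrite mulr_sumr; apply: ler_sum_nat => d /andP[d1 dD].
  apply: le_trans (ler_wpM2r (expR_ge0 _) (corr d dD)).
  rewrite -[leRHS]mulrA -expRD exprMn cE ler_wpM2l ?(ltW S0)// ler_expR; lra.
have fin : Q * (S * (2 * \sum_(0 <= d < D) expR (- (c * d%:R) ^+ 2) - 1)) <= B * M%:R * S.
  exact: le_trans (ler_wpM2l Q0 main) (le_trans lo up).
have fin' : Q * (2 * \sum_(0 <= d < D) expR (- (c * d%:R) ^+ 2) - 1) <= B * M%:R.
  by rewrite -(ler_pM2r S0); apply: le_trans fin; rewrite -mulrA [S * _]mulrC.
apply: le_trans fin'; rewrite ler_wpM2l// lerD2r ler_pdivrMr//.
by have := sum_expR_sqr_ge c0 Dc; lra.
Qed.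

End Kernel.

(** * Counting words over a finite alphabet *)

Section Words.
Context {R : numDomainType} {T : finType}.

Fixpoint words (a : nat) : seq (seq T) :=
  if a is a'.+1 then [seq t :: w | t <- enum T, w <- words a'] else [:: [::]].

Lemma big_wordsS a (F : seq T -> R) :
  \sum_(w <- words a.+1) F w = \sum_t \sum_(w <- words a) F (t :: w).
Proof.
by rewrite /= big_allpairs_dep big_enum.
Qed.

Lemma size_words a w : w \in words a -> size w = a.
Proof.
elim: a w => [|a IH] w /=; first by rewrite inE => /eqP ->.
by move=> /allpairsP[[t v] [_ /= /IH <- ->]].
Qed.

Lemma sum_words_prod a (g : T -> R) :
  \sum_(w <- words a) \prod_(t <- w) g t = (\sum_t g t) ^+ a.
Proof.
elim: a => [|a IH]; first by rewrite /= big_seq1 big_nil.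
rewrite big_wordsS exprS mulr_suml; apply: eq_bigr => t _.
by rewrite -IH mulr_sumr; apply: eq_bigr => w _; rewrite big_cons.
Qed.

(* [2 ^ (size s - number of distinct letters of s)] *)
Definition excess (s : seq T) : R := \prod_t 2 ^+ (count_mem t s).-1.

Lemma excess_ge0 s : 0 <= excess s.
Proof. by apply: prodr_ge0 => t _; rewrite exprn_ge0. Qed.

Lemma excess_perm s1 s2 : perm_eq s1 s2 -> excess s1 = excess s2.
Proof. by move=> /permP e; apply: eq_bigr => t _; rewrite e. Qed.

Lemma excess_rem t s : t \in s ->
  excess s = (minn (count_mem t s) 2)%:R * excess (rem t s).
Proof.
move=> ts; rewrite /excess (bigD1 t)//= [in RHS](bigD1 t)//= mulrA; congr (_ * _).
  rewrite count_rem ts/= eqxx.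
  have : (0 < count_mem t s)%N by rewrite -has_count has_pred1.
  case: (count_mem t s) => [//|[|n]] _ /=; first by rewrite expr0 mulr1.
  by rewrite exprS; congr (_%:R * _); lia.
apply: eq_bigr => u ut; rewrite count_rem ts/=.
by rewrite eq_sym (negPf ut) subn0.
Qed.

Definition arrangements (X : seq (seq T)) (s : seq T) : nat := count (perm_eq^~ s) X.

Lemma arrangements_cons t X s :
  arrangements [seq t :: w | w <- X] s = ((t \in s) * arrangements X (rem t s))%N.
Proof.
rewrite /arrangements count_map; case: (boolP (t \in s)) => ts; last first.
  rewrite mul0n; apply/eqP; rewrite -leqn0 leqNgt -has_count; apply/hasPn => w _ /=.
  by apply: contra ts => /perm_mem <-; rewrite mem_head.
rewrite mul1n; apply: eq_count => w /=.
by have /permPr -> := perm_to_rem ts; rewrite perm_cons.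
Qed.

Lemma arrangements_flatten (f : T -> seq (seq T)) s :
  arrangements (flatten [seq f t | t <- enum T]) s = (\sum_t arrangements (f t) s)%N.
Proof.
by rewrite /arrangements count_flatten -map_comp sumnE big_map big_enum.
Qed.

Lemma arrangements_words a s :
  arrangements (words a.+1) s = (\sum_(t in s) arrangements (words a) (rem t s))%N.
Proof.
rewrite /= (arrangements_flatten (fun t => [seq t :: w | w <- words a])).
rewrite [RHS]big_mkcond/=; apply: eq_bigr => t _.
by rewrite arrangements_cons; case: ifP => _; rewrite ?mul0n ?mul1n.
Qed.

(** The defect [count_mem t s - 2] is kept exactly: it is the gain that the induction on tripled
    words consumes. *)
Lemma sum_minn_count (s : seq T) :
  (\sum_(t in s) minn (count_mem t s) 2 + \sum_t (count_mem t s - 2) = size s)%N.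
Proof.
have -> : size s = (\sum_(t in s) count_mem t s)%N.
  rewrite -sum1_size; rewrite -(eq_bigr _ (fun t _ => sum1_count _ _)).
  rewrite (exchange_big_dep xpredT)//=.
  rewrite [RHS](_ : _ = (\sum_(i <- s) 1)%N)//.
  apply: eq_big_seq => t ts.
  rewrite (bigD1 t)/=; last by rewrite ts eqxx.
  by rewrite big1// => u /andP[/andP[_ /eqP ->]]; rewrite eqxx.
rewrite [X in (_ + X)%N](bigID (mem s))/= [X in (_ + (_ + X))%N]big1 => [|t ts].
  by rewrite addn0 -big_split/=; apply: eq_bigr => t _; lia.
by rewrite (count_memPn ts).
Qed.

(** Division-free form of $\prod_t 2^{m_t-1}/m_t! \le 1$. Splitting by the first letter [t] costs
    [minn (count_mem t s) 2], and these costs add up to at most the length. *)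
Lemma excess_arrangements a s : size s = a ->
  excess s * (arrangements (words a) s)%:R <= a`!%:R.
Proof.
elim: a s => [|a IH] s sa.
  by rewrite (size0nil sa) /excess big1// mulr1.
rewrite arrangements_words natr_sum mulr_sumr.
apply: (@le_trans _ _ (\sum_(t in s) (minn (count_mem t s) 2)%:R * a`!%:R)).
  apply: ler_sum => t ts; rewrite (excess_rem ts) -mulrA ler_wpM2l//.
  by apply: IH; rewrite size_rem// sa.
rewrite -mulr_suml -natr_sum factS natrM ler_wpM2r// ler_nat.
by have := sum_minn_count s; rewrite sa; lia.
Qed.

(** Here [a] counts the free letters only. The three prescribed ones force the repetition that
    lowers the weight of a multiset. *)
Definition tripled_words (a : nat) : seq (seq T) :=
  [seq [:: e, e, e & w] | e <- enum T, w <- words a].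

Lemma big_tripled_words a (F : seq T -> R) :
  \sum_(w <- tripled_words a) F w = \sum_e \sum_(w <- words a) F [:: e, e, e & w].
Proof. by rewrite big_allpairs_dep big_enum. Qed.

Lemma size_tripled_words a w : w \in tripled_words a -> size w = a.+3.
Proof. by move=> /allpairsP[[t v] [_ /= /size_words <- ->]]. Qed.

Lemma arrangements_tripled a s : arrangements (tripled_words a) s =
  (\sum_e (2 < count_mem e s) * arrangements (words a) (rem e (rem e (rem e s))))%N.
Proof.
rewrite /tripled_words (arrangements_flatten (fun e => [seq [:: e, e, e & w] | w <- words a])).
apply: eq_bigr => e _.
have -> : [seq [:: e, e, e & w] | w <- words a] =
   [seq e :: w | w <- [seq e :: w | w <- [seq e :: w | w <- words a]]].
  by rewrite -!map_comp.
rewrite !arrangements_cons !mulnA; congr (_ * _)%N.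
rewrite -!has_pred1 !has_count.
case: (posnP (count_mem e s)) => [->//|c1].
have es : e \in s by rewrite -has_pred1 has_count.
have c2 : count_mem e (rem e s) = (count_mem e s).-1.
  by rewrite count_rem es/= eqxx subn1.
case: (posnP (count_mem e (rem e s))) => [h|c3].
  by rewrite muln0 mul0n; rewrite c2 in h; case: ltnP => //; lia.
have es2 : e \in rem e s by rewrite -has_pred1 has_count.
have -> : count_mem e (rem e (rem e s)) = (count_mem e s).-2.
  by rewrite count_rem es2/= eqxx subn1 c2.
by rewrite !mul1n; congr (nat_of_bool _); lia.
Qed.

Lemma natr_arrangements X s :
  (arrangements X s)%:R = \sum_(w <- X) (perm_eq w s)%:R :> R.
Proof. by rewrite /arrangements -sum1_count big_mkcond natr_sum. Qed.

(** The first free letter is moved in front of the triple, which permutes the word and exposes a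
    shorter tripled word. *)
Lemma arrangements_tripledS a s : (arrangements (tripled_words a.+1) s)%:R =
  \sum_(t in s) (arrangements (tripled_words a) (rem t s))%:R :> R.
Proof.
rewrite natr_arrangements big_tripled_words.
under eq_bigr do rewrite big_wordsS.
rewrite exchange_big/= [RHS]big_mkcond/=; apply: eq_bigr => t _.
rewrite -[RHS](_ : (arrangements [seq t :: w | w <- tripled_words a] s)%:R = _); last first.
  by rewrite arrangements_cons; case: ifP; rewrite ?mul1n ?mul0n.
rewrite natr_arrangements big_map big_tripled_words; apply: eq_bigr => e _.
apply: eq_bigr => w _; congr (_ (nat_of_bool _)).
exact: (perm_catCA [:: e; e; e] [:: t] w s).
Qed.

Lemma excess_triple e s : (2 < count_mem e s)%N ->
  excess s <= 8 * excess (rem e (rem e (rem e s))).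
Proof.
have m2 (n : nat) : (minn n 2)%:R <= 2 :> R by rewrite ler_nat geq_minr.
have st u : e \in u -> excess u <= 2 * excess (rem e u).
  by move=> eu; rewrite (excess_rem eu) ler_wpM2r ?excess_ge0.
move=> c3; have e1 : e \in s by rewrite -has_pred1 has_count; lia.
have c1 : count_mem e (rem e s) = (count_mem e s).-1.
  by rewrite count_rem e1/= eqxx subn1.
have e2 : e \in rem e s by rewrite -has_pred1 has_count; lia.
have c2 : count_mem e (rem e (rem e s)) = (count_mem e s).-2.
  by rewrite count_rem e2/= eqxx subn1 c1.
have e4 : e \in rem e (rem e s) by rewrite -has_pred1 has_count; lia.
apply: le_trans (st _ e1) _; have -> : 8 = 2 * (2 * 2) :> R by ring.
rewrite -!mulrA ler_wpM2l//; apply: le_trans (st _ e2) _; rewrite ler_wpM2l//.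
exact: st.
Qed.

Lemma excess_tripled_few a s : size s = a.+3 ->
  (\sum_t (count_mem t s - 2) <= 2)%N ->
  excess s * (arrangements (tripled_words a) s)%:R <= 16 * a`!%:R.
Proof.
move=> sa few; rewrite arrangements_tripled natr_sum mulr_sumr.
apply: (@le_trans _ _ (\sum_t (count_mem t s - 2)%:R * (8 * a`!%:R))).
  apply: ler_sum => e _; case: (ltnP 2 (count_mem e s)) => c; last first.
    by rewrite mul0n mulr0 mulr_ge0// mulr_ge0.
  rewrite mul1n.
  apply: (@le_trans _ _ (8 * a`!%:R)); last first.
    by rewrite ler_peMl ?mulr_ge0// ler1n; lia.
  apply: le_trans (ler_wpM2r (ler0n _ _) (excess_triple c)) _.
  rewrite -mulrA ler_wpM2l//; apply: excess_arrangements.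
  have e1 : e \in s by rewrite -has_pred1 has_count; lia.
  have c1 : count_mem e (rem e s) = (count_mem e s).-1.
    by rewrite count_rem e1/= eqxx subn1.
  have e2 : e \in rem e s by rewrite -has_pred1 has_count; lia.
  have c2 : count_mem e (rem e (rem e s)) = (count_mem e s).-2.
    by rewrite count_rem e2/= eqxx subn1 c1.
  have e4 : e \in rem e (rem e s) by rewrite -has_pred1 has_count; lia.
  by rewrite !size_rem// sa.
rewrite -mulr_suml -natr_sum mulrA ler_wpM2r//.
rewrite -[leRHS](_ : 2 * 8 = _); last by ring.
by rewrite ler_wpM2r// ler_nat.
Qed.

(** Once the defect is at least 3, the costs [minn (count_mem t s) 2] add up to at most the number
    of free letters, not the full length. The induction then multiplies the bound by exactly the
    factor that the factorial gains. *)
Lemma excess_tripled a s : size s = a.+3 ->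
  excess s * (arrangements (tripled_words a) s)%:R <= 16 * a`!%:R.
Proof.
elim: a s => [|a IH] s sa.
  apply: excess_tripled_few => //.
  case: s sa => [//|t0 s] sa.
  have := sum_minn_count (t0 :: s); rewrite sa (bigD1 t0) ?mem_head//=.
  rewrite eqxx; lia.
have [few|many] := leqP (\sum_t (count_mem t s - 2)) 2.
  exact: excess_tripled_few.
rewrite arrangements_tripledS mulr_sumr.
apply: (@le_trans _ _ (\sum_(t in s) (minn (count_mem t s) 2)%:R * (16 * a`!%:R))).
  apply: ler_sum => t ts; rewrite (excess_rem ts) -mulrA ler_wpM2l//.
  by apply: IH; rewrite size_rem// sa.
rewrite -mulr_suml -natr_sum factS natrM mulrCA ler_wpM2l// ler_wpM2r// ler_nat.
by have := sum_minn_count s; rewrite sa; lia.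
Qed.

Lemma prod_count (f : T -> R) s : \prod_(t <- s) f t = \prod_t f t ^+ count_mem t s.
Proof.
elim: s => [|u s IH]; first by rewrite big_nil big1.
rewrite big_cons IH /= (eq_bigr _ (fun t _ => exprD _ _ _)) big_split/=.
congr (_ * _); rewrite (bigD1 u)//= eqxx expr1 big1 ?mulr1// => t /negPf tu.
by rewrite eq_sym tu expr0.
Qed.

(** An indicator doubled so that its average over the two sides is 1. *)
Definition onside (b : bool) : R := if b then 2 else 0.

Definition sign_weight (sg : {ffun T -> bool}) (x y : seq T) : R :=
  (\prod_(t <- x) onside (sg t)) * \prod_(t <- y) onside (~~ sg t).

(** The sum factors over letters. A letter absent from both words gives 2, a letter of multiplicity
    $m \ge 1$ in just one of them gives $2^m$, and a common letter gives 0: this is how disjointness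
    is enforced. *)
Lemma sum_sign_weight x y : \sum_sg sign_weight sg x y =
  2 ^+ #|T| * (excess x * excess y * (~~ has (mem x) y)%:R).
Proof.
pose F t b := onside b ^+ count_mem t x * onside (~~ b) ^+ count_mem t y.
have -> : \sum_sg sign_weight sg x y = \prod_t \sum_b F t b.
  rewrite bigA_distr_bigA/=; apply: eq_bigr => sg _.
  rewrite /sign_weight (prod_count (fun t => onside (sg t))).
  by rewrite (prod_count (fun t => onside (~~ sg t))) -big_split.
case: (boolP (has (mem x) y)) => [/hasP[t ty tx]|dis].
  rewrite !mulr0 (bigD1 t)//= big_bool/= /F /onside/=.
  have /negPf cx : count_mem t x != 0%N by rewrite -lt0n -has_count has_pred1.
  have /negPf cy : count_mem t y != 0%N by rewrite -lt0n -has_count has_pred1.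
  by rewrite !expr0n cx cy mulr0 mul0r addr0 mul0r.
rewrite mulr1 /excess -big_split/= -prodr_const -big_split/=.
apply: eq_bigr => t _; rewrite big_bool/= /F /onside/= !expr0n.
have [tx|tx] := boolP (t \in x).
  have ty : t \notin y by apply: contra dis => ty; apply/hasP; exists t.
  rewrite (count_memPn ty) expr0 mulr1 eqxx.
  have : (0 < count_mem t x)%N by rewrite -has_count has_pred1.
  case: (count_mem t x) => [//|n] _ /=.
  by rewrite addr0 !mulr1 exprS.
rewrite (count_memPn tx) eqxx/= expr0 !mul1r.
case: (count_mem t y) => [|n] /=; first by rewrite expr0 mulr1.
by rewrite add0r exprS.
Qed.

(** By uniqueness, all disjoint pairs with difference [m] rearrange a single pair [(x0, y0)]. The
    average is therefore bounded by the two weighted arrangement counts of that pair. *)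
Lemma sum_signed_words_le (f : T -> int) (X Y : seq (seq T)) (Bx By : R) (m : int) :
  let diff x y := \sum_(t <- x) f t - \sum_(t <- y) f t in
  (forall x y x' y', x \in X -> y \in Y -> x' \in X -> y' \in Y ->
     ~~ has (mem x) y -> ~~ has (mem x') y' -> diff x y = diff x' y' ->
     perm_eq x x' /\ perm_eq y y') ->
  (forall s, s \in X -> excess s * (arrangements X s)%:R <= Bx) ->
  (forall s, s \in Y -> excess s * (arrangements Y s)%:R <= By) ->
  0 <= Bx -> 0 <= By ->
  \sum_sg \sum_(x <- X) \sum_(y <- Y) sign_weight sg x y * (diff x y == m)%:R
    <= 2 ^+ #|T| * (Bx * By).
Proof.
move=> diff uniq BX BY Bx0 By0.
pose good x y := ~~ has (mem x) y && (diff x y == m).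
have -> : \sum_sg \sum_(x <- X) \sum_(y <- Y) sign_weight sg x y * (diff x y == m)%:R =
  2 ^+ #|T| * \sum_(x <- X) \sum_(y <- Y) excess x * excess y * (good x y)%:R.
  rewrite exchange_big/= mulr_sumr; apply: eq_bigr => x _.
  rewrite exchange_big/= mulr_sumr; apply: eq_bigr => y _.
  rewrite -mulr_suml sum_sign_weight /good.
  by case: (~~ has _ _); case: (diff x y == m); rewrite /= ?mulr1 ?mulr0 ?mul0r ?mulr1.
rewrite ler_wpM2l ?exprn_ge0//.
have [/hasP[x0 xX /hasP[y0 yY /andP[dis0 /eqP e0]]]|no] := boolP (has (fun x => has (good x) Y) X).
  apply: le_trans (ler_pM _ _ (BX _ xX) (BY _ yY)); last 2 first.
  - by rewrite mulr_ge0 ?excess_ge0.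
  - by rewrite mulr_ge0 ?excess_ge0.
  rewrite mulrACA !natr_arrangements big_distrlr/= mulr_sumr big_seq [leRHS]big_seq.
  apply: ler_sum => x xX'; rewrite mulr_sumr big_seq [leRHS]big_seq.
  apply: ler_sum => y yY'.
  have [/andP[dis /eqP e]|_] := boolP (good x y); last first.
    by rewrite mulr0 mulr_ge0// mulr_ge0 ?excess_ge0.
  have [|p q] := uniq _ _ _ _ xX' yY' xX yY dis dis0; first by rewrite e e0.
  by rewrite p q !mulr1 (excess_perm p) (excess_perm q).
rewrite big_seq big1 ?mulr_ge0// => x xX; rewrite big_seq big1// => y yY.
have [g|_] := boolP (good x y); last by rewrite mulr0.
by case/negP: no; apply/hasP; exists x => //; apply/hasP; exists y.
Qed.

End Words.

(** * Characteristic functions *)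

Section CharacteristicFunctions.
Context {R : realType} {T : finType}.
Implicit Types g h psi : T -> R.

(* Real and imaginary parts of [(p + i q) ^ a]. *)
Fixpoint cpow (p q : R) (a : nat) : R * R :=
  if a is a'.+1 then
    let z := cpow p q a' in (p * z.1 - q * z.2, p * z.2 + q * z.1)
  else (1, 0).

(** The free phase [phi] lets the induction on the first letter close; the choice [- (pi / 2)] later
    recovers the imaginary part. *)
Lemma sum_words_cos a g psi phi :
  let p := \sum_t g t * cos (psi t) in let q := \sum_t g t * sin (psi t) in
  \sum_(w <- words a) (\prod_(t <- w) g t) * cos (phi + \sum_(t <- w) psi t) =
  (cpow p q a).1 * cos phi - (cpow p q a).2 * sin phi.
Proof.
move=> p q; elim: a phi => [|a IH] phi.
  by rewrite /= big_seq1 !big_nil addr0 !mul1r mul0r subr0.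
rewrite big_wordsS.
rewrite (eq_bigr (fun t => (cpow p q a).1 * cos phi * (g t * cos (psi t)) -
   (cpow p q a).1 * sin phi * (g t * sin (psi t)) -
   (cpow p q a).2 * sin phi * (g t * cos (psi t)) -
   (cpow p q a).2 * cos phi * (g t * sin (psi t)))); last first.
  move=> t _; rewrite (eq_bigr (fun w => g t *
    ((\prod_(t <- w) g t) * cos ((phi + psi t) + \sum_(t <- w) psi t)))); last first.
    by move=> w _; rewrite !big_cons addrA mulrA.
  by rewrite -mulr_sumr IH cosD sinD; ring.
by rewrite !sumrB -!mulr_sumr -/p -/q /=; ring.
Qed.

Lemma sum_words2_cos a b g h psi :
  let p := \sum_t g t * cos (psi t) in let q := \sum_t g t * sin (psi t) in
  let p' := \sum_t h t * cos (psi t) in let q' := - \sum_t h t * sin (psi t) in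
  \sum_(x <- words a) \sum_(y <- words b) (\prod_(t <- x) g t) * (\prod_(t <- y) h t) *
    cos (\sum_(t <- x) psi t - \sum_(t <- y) psi t) =
  (cpow p q a).1 * (cpow p' q' b).1 - (cpow p q a).2 * (cpow p' q' b).2.
Proof.
move=> p q p' q'.
have p'E : p' = \sum_t h t * cos (- psi t) by apply: eq_bigr => t _; rewrite cosN.
have q'E : q' = \sum_t h t * sin (- psi t).
  by rewrite /q' -sumrN; apply: eq_bigr => t _; rewrite sinN mulrN.
have inner (x : seq T) : \sum_(y <- words b) (\prod_(t <- x) g t) * (\prod_(t <- y) h t) *
    cos (\sum_(t <- x) psi t - \sum_(t <- y) psi t) =
    (cpow p' q' b).1 * ((\prod_(t <- x) g t) * cos (0 + \sum_(t <- x) psi t)) -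
    (cpow p' q' b).2 * ((\prod_(t <- x) g t) * cos (- (pi / 2) + \sum_(t <- x) psi t)).
  have := sum_words_cos b h (fun t => - psi t) (\sum_(t <- x) psi t).
  rewrite /= -p'E -q'E [- _ + _]addrC cosBpihalf add0r => e.
  rewrite (eq_bigr (fun y => (\prod_(t <- x) g t) * ((\prod_(t <- y) h t) *
    cos (\sum_(t <- x) psi t + \sum_(t <- y) - psi t)))).
    by rewrite -mulr_sumr e; ring.
  by move=> y _; rewrite sumrN mulrA.
rewrite (eq_bigr _ (fun x _ => inner x)) sumrB -!mulr_sumr.
rewrite (sum_words_cos a g psi 0) (sum_words_cos a g psi (- (pi / 2))) -/p -/q.
by rewrite cos0 sin0 cosN sinN cos_pihalf sin_pihalf; ring.
Qed.

(** With $S = at$, one more factor sends the real error $S^2$ to at most $S^2 + 2St \le (S+t)^2$ and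
    the imaginary bound $2S$ to $2(S+t)$. This gives positivity of the real part without arguments
    of complex numbers. *)
Lemma cpow_bounds (p q t : R) a : 0 <= p -> 0 <= t -> `|q| <= t * p -> a%:R * t <= 2^-1 ->
  `|(cpow p q a).1 - p ^+ a| <= p ^+ a * (a%:R * t) ^+ 2 /\
  `|(cpow p q a).2| <= p ^+ a * (2 * (a%:R * t)).
Proof.
move=> p0 t0 qt; elim: a => [|a IH] at2.
  by rewrite /= subrr normr0 expr0 mul0r expr0n/= mulr0.
have at2' : a%:R * t <= 2^-1 by apply: le_trans at2; rewrite ler_wpM2r// ler_nat.
have [h1 h2] := IH at2'.
have pa0 : 0 <= p ^+ a by rewrite exprn_ge0.
have S0 : 0 <= a%:R * t by rewrite mulr_ge0.
have ES : a.+1%:R * t = a%:R * t + t by rewrite -natr1 mulrDl mul1r.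
rewrite ES /= in at2 *; move: (a%:R * t) S0 at2 at2' h1 h2 => S S0 at2 at2' h1 h2.
move: (cpow p q a) (p ^+ a) pa0 h1 h2 (exprS p a) => [u v] A A0 /= h1 h2 ->.
split.
  have -> : p * u - q * v - p * A = p * (u - A) - q * v by ring.
  apply: le_trans (ler_normB _ _) _; rewrite !normrM (ger0_norm p0).
  apply: (@le_trans _ _ (p * (A * S ^+ 2) + (t * p) * (A * (2 * S)))).
    by apply: lerD; [rewrite ler_wpM2l|apply: ler_pM].
  have : 0 <= p * A * t ^+ 2 by rewrite !mulr_ge0 ?sqr_ge0.
  lra.
apply: le_trans (ler_normD _ _) _; rewrite !normrM (ger0_norm p0).
have uA : `|u| <= A * 2.
  have -> : u = (u - A) + A by ring.
  apply: le_trans (ler_normD _ _) _; rewrite (ger0_norm A0).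
  have : A * S ^+ 2 <= A * 1 by rewrite ler_wpM2l//; nra.
  by lra.
apply: (@le_trans _ _ (p * (A * (2 * S)) + (t * p) * (A * 2))).
  by apply: lerD; [rewrite ler_wpM2l|apply: ler_pM].
by rewrite le_eqVlt; apply/orP; left; apply/eqP; ring.
Qed.

Lemma cpow2_lb (p q p' q' t : R) a b : 0 <= p -> 0 <= p' -> 0 <= t ->
  `|q| <= t * p -> `|q'| <= t * p' -> (a + b)%:R * t <= 2^-1 ->
  p ^+ a * p' ^+ b * (1 - 2 * ((a + b)%:R * t) ^+ 2) <=
  (cpow p q a).1 * (cpow p' q' b).1 - (cpow p q a).2 * (cpow p' q' b).2.
Proof.
move=> p0 p'0 t0 qt q't; rewrite natrD mulrDl => st.
have Sa0 : 0 <= a%:R * t by rewrite mulr_ge0.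
have Sb0 : 0 <= b%:R * t by rewrite mulr_ge0.
have [|u1 u2] := @cpow_bounds p q t a p0 t0 qt; first lra.
have [|v1 v2] := @cpow_bounds p' q' t b p'0 t0 q't; first lra.
have A0 : 0 <= p ^+ a by rewrite exprn_ge0.
have B0 : 0 <= p' ^+ b by rewrite exprn_ge0.
move: (a%:R * t) (b%:R * t) (cpow p q a) (cpow p' q' b) (p ^+ a) (p' ^+ b)
  Sa0 Sb0 st A0 B0 u1 u2 v1 v2 => S S' [r i] [r' i'] A B S0 S'0 st A0 B0 /= u1 u2 v1 v2.
have r1 : A * (1 - S ^+ 2) <= r.
  by have := le_trans (ler_norm _) u1; have := u1; rewrite distrC => /(le_trans (ler_norm _)); lra.
have r2 : B * (1 - S' ^+ 2) <= r'.
  by have := v1; rewrite distrC => /(le_trans (ler_norm _)); lra.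
have s1 : 0 <= 1 - S ^+ 2 by nra.
have s2 : 0 <= 1 - S' ^+ 2 by nra.
have rr : (A * (1 - S ^+ 2)) * (B * (1 - S' ^+ 2)) <= r * r'.
  by apply: ler_pM => //; rewrite mulr_ge0.
have ii : i * i' <= (A * (2 * S)) * (B * (2 * S')).
  by apply: le_trans (ler_norm _) _; rewrite normrM; apply: ler_pM.
apply: le_trans (lerB rr ii).
have -> : A * (1 - S ^+ 2) * (B * (1 - S' ^+ 2)) - A * (2 * S) * (B * (2 * S')) =
  A * B * ((1 - S ^+ 2) * (1 - S' ^+ 2) - 4 * S * S') by ring.
rewrite ler_wpM2l ?mulr_ge0//.
have : 0 <= S ^+ 2 * S' ^+ 2 by rewrite mulr_ge0 ?sqr_ge0.
by have := sqr_ge0 S; have := sqr_ge0 S'; lra.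
Qed.


(** * Characteristic functions at frequencies up to order $k^{-1/3}/n$ *)

Section Frequencies.
Variables (y : T -> R) (n : R).
Let N : R := #|T|%:R.
Hypothesis n_gt0 : 0 < n.
Hypothesis y_le : forall t, `|y t| <= n.
Hypothesis y_mean : \sum_t y t = 0.
Hypothesis y_var : \sum_t y t ^+ 2 <= N * (n ^+ 2 / 4).

Let sumN (x : R) : \sum_(t : T) x = N * x.
Proof. by rewrite sumr_const mulr_natl. Qed.

Lemma sum_cos_ge (tau : R) :
  N * (1 - tau ^+ 2 / 8) <= \sum_t cos (tau / n * y t).
Proof.
apply: (@le_trans _ _ (\sum_t (1 - (tau / n) ^+ 2 / 2 * y t ^+ 2))); last first.
  by apply: ler_sum => t _; apply: le_trans (cos_ge_sqr _); rewrite exprMn; lra.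
rewrite sumrB sumN -mulr_sumr mulrBr lerD2l lerN2.
have h : 0 <= (tau / n) ^+ 2 / 2 by rewrite divr_ge0 ?sqr_ge0.
apply: le_trans (ler_wpM2l h y_var) _.
by rewrite le_eqVlt; apply/orP; left; apply/eqP; field; rewrite gt_eqF.
Qed.

Lemma norm_scaled_le (tau : R) t : 0 <= tau -> `|tau / n * y t| <= tau.
Proof.
move=> t0; rewrite normrM ger0_norm ?divr_ge0 ?(ltW n_gt0)// mulrAC ler_pdivrMr//.
by rewrite ler_wpM2l.
Qed.

Lemma sum_weighted_sin_le (tau c : R) (f : T -> R) : 0 <= tau ->
  (forall t, `|f t| <= 1) -> `|\sum_t f t * y t| <= N * (n * c) ->
  `|\sum_t f t * sin (tau / n * y t)| <= N * (tau * c + tau ^+ 3).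
Proof.
move=> t0 f1 fc.
have -> : \sum_t f t * sin (tau / n * y t) = tau / n * \sum_t f t * y t +
    \sum_t f t * (sin (tau / n * y t) - tau / n * y t).
  by rewrite mulr_sumr -big_split/=; apply: eq_bigr => t _; ring.
apply: le_trans (ler_normD _ _) _; rewrite mulrDr lerD//.
  rewrite normrM ger0_norm ?divr_ge0 ?(ltW n_gt0)//.
  apply: le_trans (ler_wpM2l _ fc) _; first by rewrite divr_ge0 ?(ltW n_gt0).
  by rewrite le_eqVlt; apply/orP; left; apply/eqP; field; rewrite gt_eqF.
apply: le_trans (ler_norm_sum _ _ _) _; rewrite -sumN; apply: ler_sum => t _.
rewrite normrM -[leRHS]mul1r; apply: ler_pM => //.
apply: le_trans (sin_sub_le _) _.
by rewrite lerXn2r ?nnegrE ?normr_ge0 ?norm_scaled_le.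
Qed.

(** Centring kills the linear term, so only the cubic remainder is left. *)
Lemma sum_sin_le (tau : R) : 0 <= tau ->
  `|\sum_t sin (tau / n * y t)| <= N * tau ^+ 3.
Proof.
move=> t0; have := @sum_weighted_sin_le tau 0 (fun=> 1) t0.
rewrite !(eq_bigr _ (fun t _ => mul1r _)) (mulr0 tau) add0r; apply.
  by move=> t; rewrite normr1.
by rewrite y_mean normr0 !mulr0.
Qed.

Lemma sum_weighted_cos_le (tau c : R) (f : T -> R) : 0 <= tau ->
  (forall t, `|f t| <= 1) -> `|\sum_t f t| <= N * c ->
  `|\sum_t f t * cos (tau / n * y t)| <= N * (c + tau ^+ 2 / 2).
Proof.
move=> t0 f1 fc.
have -> : \sum_t f t * cos (tau / n * y t) = \sum_t f t -
    \sum_t f t * (1 - cos (tau / n * y t)).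
  by rewrite -sumrB; apply: eq_bigr => t _; ring.
apply: le_trans (ler_normB _ _) _; rewrite mulrDr lerD//.
apply: le_trans (ler_norm_sum _ _ _) _; rewrite -sumN; apply: ler_sum => t _.
rewrite normrM -[leRHS]mul1r; apply: ler_pM => //.
rewrite ger0_norm ?subr_ge0 ?cos_le1//.
have := cos_ge_sqr (tau / n * y t).
have : (tau / n * y t) ^+ 2 <= tau ^+ 2.
  rewrite -(real_normK (num_real (tau / n * y t))).
  by rewrite lerXn2r ?nnegrE ?normr_ge0 ?norm_scaled_le.
lra.
Qed.

Variables (k : nat) (q u : R).
Hypothesis qk : q ^+ 3 = k%:R.
Hypothesis q1 : 1 <= q.
Hypothesis u0 : 0 <= u.
Hypothesis u8 : u <= 8^-1.
Let tau := u / q.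
Let w := q^-1.

Let w0 : 0 < w. Proof. by rewrite invr_gt0 (lt_le_trans _ q1). Qed.
Let w1 : w <= 1. Proof. by rewrite invf_le1 ?(lt_le_trans _ q1). Qed.
Let qw : q * w = 1. Proof. by rewrite mulfV// gt_eqF// (lt_le_trans _ q1). Qed.
Let tau0 : 0 <= tau. Proof. by rewrite mulr_ge0// ltW. Qed.
Let kE : k%:R * w ^+ 3 = 1. Proof. by rewrite -qk -exprMn qw expr1n. Qed.

Let kw2 : k%:R * w ^+ 2 = q.
Proof.
transitivity (k%:R * w ^+ 2 * (q * w)); first by rewrite qw mulr1.
by transitivity (k%:R * w ^+ 3 * q); [ring|rewrite kE mul1r].
Qed.
Let kw4 : k%:R * w ^+ 4 = w.
Proof. by rewrite exprSr mulrA kE mul1r. Qed.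
Let u2 : u ^+ 2 <= u * 8^-1. Proof. by rewrite expr2 ler_wpM2l. Qed.
Let u64 : u ^+ 2 <= 64^-1. Proof. by have := u2; have := u8; lra. Qed.
Let u3 : u ^+ 3 <= u * 64^-1. Proof. by rewrite exprS ler_wpM2l. Qed.
Let u4 : u ^+ 4 <= u ^+ 2 * 64^-1.
Proof. by rewrite (exprD _ 2 2) ler_wpM2l ?sqr_ge0. Qed.
Let u6 : u ^+ 6 <= u ^+ 2 * 64^-1.
Proof.
by rewrite (exprD _ 2 4) ler_wpM2l ?sqr_ge0//; have := u4; have := u64; lra.
Qed.
Let tau8 : tau <= 8^-1.
Proof. by rewrite -[leRHS]mulr1; apply: ler_pM => //; exact: ltW. Qed.
Let tau64 : tau ^+ 2 <= 64^-1.
Proof.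
have -> : 64^-1 = (8^-1) ^+ 2 :> R by lra.
by rewrite lerXn2r ?nnegrE.
Qed.

(** The main exponent [q * u ^+ 2 / 8] is half the variance bound $kn^2/4$ times the squared
    frequency. The second-order loss is of size $k\tau^4 = w u^4$ and fits into [u ^+ 2]. *)
Let mean_cos_pow :
  N ^+ k * expR (- (q * u ^+ 2 / 8 + u ^+ 2)) <= (\sum_t cos (tau / n * y t)) ^+ k.
Proof.
have N0 : 0 <= N by [].
have t8 := tau64.
have t20 := sqr_ge0 tau.
apply: (@le_trans _ _ ((N * expR (- (tau ^+ 2 / 8 + 2 * (tau ^+ 2 / 8) ^+ 2))) ^+ k)).
  rewrite exprMn -expRM_natl ler_wpM2l ?exprn_ge0// ler_expR mulrN lerN2.
  rewrite /tau -/w.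
  have -> : k%:R * ((u * w) ^+ 2 / 8 + 2 * ((u * w) ^+ 2 / 8) ^+ 2) =
     (k%:R * w ^+ 2) * (u ^+ 2 / 8) + (k%:R * w ^+ 4) * (u ^+ 4 / 32) by field.
  rewrite kw2 kw4 mulrA lerD2l.
  have : w * u ^+ 4 <= 1 * u ^+ 2.
    by apply: ler_pM; rewrite ?(ltW w0)// ?exprn_ge0//; have := u4; have := sqr_ge0 u; lra.
  by have := sqr_ge0 u; lra.
rewrite lerXn2r ?nnegrE ?mulr_ge0 ?expR_ge0//.
  by apply: le_trans (sum_cos_ge _); rewrite mulr_ge0//; lra.
apply: le_trans (sum_cos_ge _); rewrite ler_wpM2l// one_sub_ge_expR//; lra.
Qed.

(** The ratio of imaginary to real part is at most $2\tau^3$ per factor, hence $2u^3$ after [k]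
    factors since $k w^3 = 1$. The restriction on [u] makes this small, and its square is absorbed
    in [5 * u ^+ 2]. *)
Lemma words_charfun_ge :
  N ^+ k * expR (- (q * u ^+ 2 / 8 + 5 * u ^+ 2)) <=
  \sum_(x <- words k) cos (\sum_(t <- x) tau / n * y t).
Proof.
have := sum_words_cos k (fun=> 1) (fun t : T => tau / n * y t) 0.
rewrite /= !(eq_bigr _ (fun t _ => mul1r _)) cos0 sin0 mulr1 mulr0 subr0.
under eq_bigr do rewrite add0r big1_eq mul1r.
move=> ->; set P := \sum_t cos _; set Q := \sum_t sin _.
have N0 : 0 <= N by [].
have PN : N * 2^-1 <= P.
  by apply: le_trans (sum_cos_ge _); rewrite ler_wpM2l//; have := tau64; lra.
have P0 : 0 <= P by apply: le_trans PN; rewrite mulr_ge0.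
have QP : `|Q| <= 2 * tau ^+ 3 * P.
  apply: le_trans (sum_sin_le tau0) _.
  have : tau ^+ 3 * (N * 2^-1) <= tau ^+ 3 * P by rewrite ler_wpM2l// exprn_ge0.
  lra.
have kt : k%:R * (2 * tau ^+ 3) = 2 * u ^+ 3.
  by rewrite /tau -/w exprMn; transitivity (k%:R * w ^+ 3 * (2 * u ^+ 3)); [ring|rewrite kE mul1r].
have t0 : 0 <= 2 * tau ^+ 3 by rewrite mulr_ge0// exprn_ge0.
have [|+ _] := @cpow_bounds P Q (2 * tau ^+ 3) k P0 t0 QP.
  by rewrite kt; have := u3; have := u8; lra.
rewrite kt distrC => /(le_trans (ler_norm _)); rewrite lerBlDr -lerBlDl => h.
apply: le_trans h.
have -> : P ^+ k - P ^+ k * (2 * u ^+ 3) ^+ 2 = P ^+ k * (1 - 4 * u ^+ 6) by ring.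
have u60 : 0 <= u ^+ 6 by rewrite exprn_ge0.
apply: (@le_trans _ _ (N ^+ k * expR (- (q * u ^+ 2 / 8 + u ^+ 2)) * expR (- (2 * (4 * u ^+ 6))))).
  rewrite -[leRHS]mulrA -expRD ler_wpM2l ?exprn_ge0// ler_expR.
  by have := u6; have := sqr_ge0 u; lra.
apply: ler_pM mean_cos_pow _ => //; rewrite ?mulr_ge0 ?exprn_ge0 ?expR_ge0//.
by apply: one_sub_ge_expR2; apply/andP; split; [lra|have := u6; have := u64; lra].
Qed.

Definition rad (b : bool) : R := onside b - 1.

Lemma norm_rad b : `|rad b| <= 1.
Proof. by case: b; rewrite /rad /onside ?sub0r ?normrN ?normr1// (_ : 2 - 1 = 1 :> R) ?normr1//; ring. Qed.

Lemma onsideE b : onside b = 1 + rad b.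
Proof. by rewrite /rad addrC subrK. Qed.

Lemma onsideN b : onside (~~ b) = 1 - rad b.
Proof. by case: b; rewrite /rad /onside/=; ring. Qed.

Variables (sg : {ffun T -> bool}) (a b : nat).
Hypothesis ab : (a = b \/ a = b.+1) /\ (a + b)%N = k.
Hypothesis sg_bal : `|\sum_t rad (sg t)| <= N * (8^-1 * w ^+ 2).
Hypothesis sg_mean : `|\sum_t rad (sg t) * y t| <= N * (n * (8^-1 * w ^+ 2)).

(** The two sides have real parts [P + C] and [P - C], where [C] measures the imbalance of the
    splitting. Compared with unsigned words, the imbalance costs only [expR (- w)], a relative error
    $k^{-1/3}$. *)
Lemma signed_words_charfun_ge :
  N ^+ k * expR (- w) * expR (- (q * u ^+ 2 / 8 + 5 * u ^+ 2)) <=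
  \sum_(x <- words a) \sum_(z <- words b) sign_weight sg x z *
     cos (\sum_(t <- x) tau / n * y t - \sum_(t <- z) tau / n * y t).
Proof.
rewrite /sign_weight (sum_words2_cos a b (fun t => onside (sg t)) (fun t => onside (~~ sg t))
  (fun t => tau / n * y t)).
set C := \sum_t rad (sg t) * cos (tau / n * y t).
set S := \sum_t rad (sg t) * sin (tau / n * y t).
set P := \sum_t cos (tau / n * y t).
set Q := \sum_t sin (tau / n * y t).
have -> : \sum_t onside (sg t) * cos (tau / n * y t) = P + C.
  by rewrite -big_split; apply: eq_bigr => t _; rewrite onsideE mulrDl mul1r.
have -> : \sum_t onside (sg t) * sin (tau / n * y t) = Q + S.
  by rewrite -big_split; apply: eq_bigr => t _; rewrite onsideE mulrDl mul1r.
have -> : \sum_t onside (~~ sg t) * cos (tau / n * y t) = P - C.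
  by rewrite -sumrB; apply: eq_bigr => t _; rewrite onsideN mulrBl mul1r.
have -> : \sum_t onside (~~ sg t) * sin (tau / n * y t) = Q - S.
  by rewrite -sumrB; apply: eq_bigr => t _; rewrite onsideN mulrBl mul1r.
have N0 : 0 <= N by [].
have w20 : 0 <= w ^+ 2 by exact: sqr_ge0.
have w21 : w ^+ 2 <= 1 by rewrite exprn_ile1// ltW.
have tt0 : 0 <= tau ^+ 2 := sqr_ge0 _.
have tt := tau64.
set g := 8^-1 * w ^+ 2 + tau ^+ 2 / 2.
have g0 : 0 <= g by rewrite /g; lra.
have Cg : `|C| <= N * g by exact: (sum_weighted_cos_le tau0 (fun t => norm_rad (sg t)) sg_bal).
have Sg : `|S| <= N * (tau * (8^-1 * w ^+ 2) + tau ^+ 3).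
  exact: (sum_weighted_sin_le tau0 (fun t => norm_rad (sg t)) sg_mean).
have Qg : `|Q| <= N * tau ^+ 3 by exact: sum_sin_le.
have Pg : N * (1 - tau ^+ 2 / 8) <= P := sum_cos_ge tau.
have Pc : N * 2^-1 + `|C| <= P.
  have h : N * (2^-1 + g) <= N * (1 - tau ^+ 2 / 8) by rewrite ler_wpM2l// /g; lra.
  lra.
have Cn := ler_norm C; have Cn' : - C <= `|C| by rewrite -normrN ler_norm.
have P0 : 0 <= P by have := normr_ge0 C; lra.
set tt3 := 2 * (2 * tau ^+ 3 + tau * (8^-1 * w ^+ 2)).
have tt30 : 0 <= tt3 by rewrite mulr_ge0// addr_ge0// mulr_ge0 ?exprn_ge0// mulr_ge0.
have Pp : N * 2^-1 <= P + C by lra.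
have Pm : N * 2^-1 <= P - C by lra.
have half : N * (2 * tau ^+ 3 + tau * (8^-1 * w ^+ 2)) = tt3 * (N * 2^-1).
  by rewrite /tt3; lra.
have q1' : `|Q + S| <= tt3 * (P + C).
  apply: le_trans (ler_normD _ _) _; apply: le_trans (ler_wpM2l tt30 Pp).
  by rewrite -half; lra.
have q2' : `|- (Q - S)| <= tt3 * (P - C).
  rewrite normrN; apply: le_trans (ler_normB _ _) _; apply: le_trans (ler_wpM2l tt30 Pm).
  by rewrite -half; lra.
have [ab1 abk] := ab.
have kt : (a + b)%:R * tt3 = 4 * u ^+ 3 + 4^-1 * u.
  rewrite abk /tt3 /tau -/w.
  transitivity (k%:R * w ^+ 3 * (4 * u ^+ 3 + 4^-1 * u)); last by rewrite kE mul1r.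
  by field.
have := u3; have := u8; have := u2; have := u64 => uu1 uu2 uu3 uu4.
have PC0 : 0 <= P + C by apply: le_trans Pp; rewrite mulr_ge0.
have PC1 : 0 <= P - C by apply: le_trans Pm; rewrite mulr_ge0.
apply: le_trans (cpow2_lb PC0 PC1 tt30 q1' q2' _); last by rewrite kt; lra.
rewrite kt.
have z0 : 0 <= 4 * g ^+ 2 by rewrite mulr_ge0 ?sqr_ge0.
have gle : g <= 8^-1 + 128^-1 by rewrite /g; lra.
have gsq : g ^+ 2 <= g * (8^-1 + 128^-1) by rewrite expr2 ler_wpM2l.
(* Factors from opposite sides are paired, so the imbalance enters only through $C^2$. At most one
   factor stays unpaired and pays the first-order loss [oneE]. *)
have prodE : P ^+ 2 * expR (- (2 * (4 * g ^+ 2))) <= (P + C) * (P - C).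
  apply: (@le_trans _ _ (P ^+ 2 * (1 - 4 * g ^+ 2))).
    rewrite ler_wpM2l ?sqr_ge0// one_sub_ge_expR2//; apply/andP; split; lra.
  have -> : (P + C) * (P - C) = P ^+ 2 - C ^+ 2 by ring.
  rewrite mulrBr mulr1 lerD2l lerN2 -(real_normK (num_real C)).
  have -> : P ^+ 2 * (4 * g ^+ 2) = (2 * P * g) ^+ 2 by ring.
  rewrite lerXn2r ?nnegrE ?normr_ge0 ?mulr_ge0//.
  by apply: le_trans Cg _; rewrite ler_wpM2r//; lra.
have oneE : P * expR (- (4 * g)) <= P + C.
  apply: (@le_trans _ _ (P * (1 - 2 * g))).
    rewrite ler_wpM2l// -[4 * g](_ : 2 * (2 * g) = _); last by ring.
    by apply: one_sub_ge_expR2; apply/andP; split; lra.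
  have : N * g <= 2 * P * g by rewrite ler_wpM2r//; lra.
  lra.
have E0 := expR_ge0.
have sq : P ^+ b.*2 * expR (- (b.*2%:R * (4 * g ^+ 2))) <= (P + C) ^+ b * (P - C) ^+ b.
  have -> : P ^+ b.*2 * expR (- (b.*2%:R * (4 * g ^+ 2))) =
     (P ^+ 2 * expR (- (2 * (4 * g ^+ 2)))) ^+ b.
    rewrite exprMn -exprM -expRM_natl -mul2n natrM; congr (_ * expR _); ring.
  by rewrite -exprMn lerXn2r ?nnegrE ?mulr_ge0 ?sqr_ge0// expR_ge0.
have eg : expR (- (4 * g)) <= 1 by rewrite expR_le1; lra.
have main : P ^+ k * expR (- (k%:R * (4 * g ^+ 2))) * expR (- (4 * g)) <=
    (P + C) ^+ a * (P - C) ^+ b.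
  case: ab1 => aE; rewrite -abk aE.
    rewrite addnn; apply: le_trans sq; apply: ler_piMr => //.
    by rewrite mulr_ge0 ?exprn_ge0.
  rewrite addSn addnn [(P + C) ^+ _]exprS -[leRHS]mulrA [P ^+ _.+1]exprS.
  rewrite (_ : P * P ^+ b.*2 * _ * _ = (P * expR (- (4 * g))) *
     (P ^+ b.*2 * expR (- (b.*2.+1%:R * (4 * g ^+ 2))))); last by ring.
  apply: ler_pM oneE _; rewrite ?mulr_ge0 ?exprn_ge0//.
  apply: le_trans sq; rewrite ler_wpM2l ?exprn_ge0// ler_expR lerN2 ler_wpM2r//.
  by rewrite ler_nat.
have kg : k%:R * (4 * g ^+ 2) <= w / 8 + u ^+ 2 / 32.
  apply: (@le_trans _ _ (k%:R * (8^-1 * w ^+ 4 + 2 * tau ^+ 4))).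
    rewrite ler_wpM2l//.
    have := sqr_ge0 (8^-1 * w ^+ 2 - tau ^+ 2 / 2); rewrite /g; lra.
  rewrite /tau -/w.
  have -> : k%:R * (8^-1 * w ^+ 4 + 2 * (u * w) ^+ 4) =
    k%:R * w ^+ 4 * (8^-1 + 2 * u ^+ 4) by ring.
  have := u4; rewrite kw4 => uu5.
  have : w * u ^+ 4 <= 1 * u ^+ 4 by rewrite ler_wpM2r ?exprn_ge0.
  lra.
have g4 : 4 * g <= w / 2 + 2 * u ^+ 2.
  have h1 : w ^+ 2 <= w * 1 by rewrite expr2 ler_wpM2l// ltW.
  have h2 : tau ^+ 2 <= u ^+ 2 * 1 by rewrite /tau -/w exprMn ler_wpM2l ?sqr_ge0.
  rewrite /g; lra.
have last1 : expR (- (2 * (2 * (5 * 16^-1 * u) ^+ 2))) <= 1 - 2 * (4 * u ^+ 3 + 4^-1 * u) ^+ 2.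
  apply: (@le_trans _ _ (1 - 2 * (5 * 16^-1 * u) ^+ 2)).
    apply: one_sub_ge_expR2; apply/andP; split; last lra.
    by rewrite mulr_ge0 ?sqr_ge0.
  rewrite lerD2l lerN2 ler_wpM2l// lerXn2r ?nnegrE ?addr_ge0 ?mulr_ge0 ?exprn_ge0//; lra.
have mc := mean_cos_pow; rewrite -/P in mc.
apply: (@le_trans _ _ (N ^+ k * expR (- (q * u ^+ 2 / 8 + u ^+ 2)) *
   expR (- (k%:R * (4 * g ^+ 2))) * expR (- (4 * g)) *
   expR (- (2 * (2 * (5 * 16^-1 * u) ^+ 2))))).
  rewrite -[leLHS]mulrA -[leRHS]mulrA -[leRHS]mulrA -[leRHS]mulrA -!expRD.
  rewrite ler_wpM2l ?exprn_ge0// ler_expR; have := ltW w0; have := sqr_ge0 u; lra.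
apply: ler_pM _ last1; rewrite ?mulr_ge0 ?exprn_ge0//.
apply: le_trans main; rewrite ler_wpM2r// ler_wpM2r//.
Qed.

End Frequencies.
End CharacteristicFunctions.

(** * Optimising the kernel *)

Section KernelEstimate.
Context {R : realType}.
Implicit Types q F E J D c a : R.

Lemma pi_le4 : (pi : R) <= 4.
Proof. by have := @pihalf_lt2 R; lra. Qed.

Lemma pi_sqr_bounds : 4 <= (pi : R) ^+ 2 <= 16.
Proof.
have h1 := pi_le4; have h2 := @pi_ge2 R.
have -> : 4 = (2 : R) ^+ 2 by ring.
have -> : 16 = (4 : R) ^+ 2 by ring.
by rewrite !lerXn2r ?nnegrE// (le_trans _ h2).
Qed.

(** [a] is the ideal width $\pi/\sqrt{2k}$. Its square has order $q^{-3}$ and all corrections to it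
    have order $q^{-4}$, so the relative error is of order $1/q$. The 320 comes from $20\pi^2 \le
    320$. *)
Lemma kernel_width_bounds q F E J :
  let c := Num.sqrt ((q / 8 + 5) * (2 * pi / q ^+ 2) ^+ 2 + 12 / J ^+ 2) in
  let a := Num.sqrt (pi ^+ 2 / (2 * q ^+ 3)) in
  0 < q -> 0 < F -> q ^+ 2 / F <= J -> 320 + 12 * (F * F) <= E ->
  [/\ 0 < a, a <= c & c <= a * (1 + E / q)].
Proof.
move=> c a q0 F0 J2 E1.
have pi0 := @pi_gt0 R; have /andP[piq2 piq] := pi_sqr_bounds.
have q20 : 0 < q ^+ 2 by rewrite exprn_gt0.
have J0 : 0 < J by apply: lt_le_trans J2; rewrite divr_gt0.
have FF : 0 < F * F by rewrite mulr_gt0.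
have E0 : 0 <= E by lra.
have Eq0 : 0 <= E / q by rewrite divr_ge0// ltW.
set c0 := pi ^+ 2 / (2 * q ^+ 3) in a *.
have c00 : 0 < c0 by rewrite divr_gt0 ?mulr_gt0 ?exprn_gt0.
set X := (2 * pi / q ^+ 2) ^+ 2 in c *.
have X0 : 0 <= X by exact: sqr_ge0.
have J2inv : 12 / J ^+ 2 <= 12 * (F * F) / q ^+ 4.
  rewrite -mulrA ler_wpM2l// ler_pdivlMr ?exprn_gt0// mulrC ler_pdivrMr ?exprn_gt0//.
  have -> : F * F * J ^+ 2 = (F * J) ^+ 2 by ring.
  have -> : q ^+ 4 = (q ^+ 2) ^+ 2 by ring.
  by rewrite lerXn2r ?nnegrE ?(ltW q20) ?(mulr_ge0 (ltW F0) (ltW J0))// mulrC -ler_pdivrMr.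
set c2 := (q / 8 + 5) * X + 12 / J ^+ 2 in c *.
have c2E : c2 = c0 + (20 * pi ^+ 2 / q ^+ 4 + 12 / J ^+ 2).
  by rewrite /c2 /X /c0; field; rewrite !gt_eqF.
have q40 : 0 <= (q ^+ 4)^-1 by rewrite invr_ge0 exprn_ge0// ltW.
have c2lb : c0 <= c2.
  rewrite c2E lerDl; apply: addr_ge0.
    by apply: mulr_ge0 => //; apply: mulr_ge0 => //; exact: sqr_ge0.
  by apply: divr_ge0 => //; exact: sqr_ge0.
have c2ub : c2 <= c0 + E / q ^+ 4.
  rewrite c2E lerD2l; apply: le_trans (lerD (lexx _) J2inv) _.
  by rewrite -mulrDl; apply: ler_wpM2r => //; lra.
have h : E / q ^+ 4 <= c0 * (2 * (E / q)).
  have -> : c0 * (2 * (E / q)) = E / q ^+ 4 * pi ^+ 2 by rewrite /c0; field; rewrite gt_eqF.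
  by apply: ler_peMr; [exact: mulr_ge0|lra].
have c2ub' : c2 <= c0 * (1 + E / q) ^+ 2.
  apply: le_trans c2ub _.
  have -> : c0 * (1 + E / q) ^+ 2 = c0 + (c0 * (2 * (E / q)) + c0 * (E / q) ^+ 2) by ring.
  rewrite lerD2l; apply: le_trans h _; rewrite lerDl.
  by apply: mulr_ge0 (ltW c00) (sqr_ge0 _).
have c20 : 0 < c2 by apply: lt_le_trans c2lb.
have Eq1 : 0 <= 1 + E / q by rewrite addr_ge0.
split; first by rewrite sqrtr_gt0.
  exact: ler_wsqrtr.
rewrite -(@ler_pXn2r _ 2) ?nnegrE ?sqrtr_ge0 ?mulr_ge0 ?sqrtr_ge0//.
by rewrite exprMn !sqr_sqrtr// ltW.
Qed.

(** [D * c] is at least of order $\sqrt q$, so the quadratic term of the exponential series already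
    gives a tail $O(1/q)$. *)
Lemma kernel_tail_bound q F D c :
  let a := Num.sqrt (pi ^+ 2 / (2 * q ^+ 3)) in
  0 < q -> 0 < F -> q ^+ 2 / (8 * F) <= D -> a <= c -> (8 * F) * (8 * F) <= q ->
  1 <= D * c /\ expR (- (D * c)) <= (8 * F) * (8 * F) / q.
Proof.
move=> a q0 F0; move: (8 * F) (mulr_gt0 (ltr0Sn R 7) F0) => {F0}F F0 D2 ac Fq.
have /andP[piq2 _] := pi_sqr_bounds.
have q20 : 0 < q ^+ 2 by rewrite exprn_gt0.
have FF : 0 < F * F by rewrite mulr_gt0.
have D0 : 0 < D by apply: lt_le_trans D2; rewrite divr_gt0.
have c00 : 0 < pi ^+ 2 / (2 * q ^+ 3) by rewrite divr_gt0 ?mulr_gt0 ?exprn_gt0 ?pi_gt0.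
have agt0 : 0 < a by rewrite sqrtr_gt0.
have Dc0 : 0 <= D * c by rewrite mulr_ge0 ?(ltW D0)// (le_trans (ltW agt0)).
have Dc2 : 2 * (q / (F * F)) <= (D * c) ^+ 2.
  apply: (@le_trans _ _ ((q ^+ 2 / F * a) ^+ 2)).
    rewrite exprMn sqr_sqrtr ?(ltW c00)//.
    have -> : (q ^+ 2 / F) ^+ 2 * (pi ^+ 2 / (2 * q ^+ 3)) = 2 * (q / (F * F)) * (pi ^+ 2 / 4).
      by field; rewrite !gt_eqF.
    apply: ler_peMr; last lra.
    by apply: mulr_ge0 => //; rewrite divr_ge0 ?ltW.
  have x0 : 0 <= q ^+ 2 / F by rewrite divr_ge0 ?ltW.
  rewrite lerXn2r ?nnegrE ?(mulr_ge0 x0 (ltW agt0))//.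
  exact: (ler_pM x0 (ltW agt0) D2 ac).
have qF : 1 <= q / (F * F) by rewrite ler_pdivlMr// mul1r.
split.
  by rewrite -(@ler_pXn2r _ 2) ?nnegrE// expr1n; lra.
have h : 1 + (D * c) ^+ 2 / 2 <= expR (D * c) by exact: (expR_ge1Dxn 1 Dc0).
rewrite expRN -[leRHS]invrK lef_pV2 ?posrE ?expR_gt0 ?invr_gt0 ?divr_gt0//.
by rewrite invf_div; lra.
Qed.

(** The leading constant is $\sqrt\pi/a$. It is at least [q], so the subtracted 1 is also a relative
    error $O(1/q)$. *)
Lemma kernel_constant_bound q F E D c :
  let a := Num.sqrt (pi ^+ 2 / (2 * q ^+ 3)) in
  16 * E <= q -> (8 * F) * (8 * F) <= 4 * E -> 1 <= E -> 0 < c ->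
  c <= a * (1 + E / q) -> expR (- (D * c)) <= (8 * F) * (8 * F) / q ->
  Num.sqrt (2 * q ^+ 3 / pi) * (1 - 16 * E / q) <=
  (Num.sqrt pi - 2 * expR (- (D * c))) / c - 1.
Proof.
move=> a qE FE E1 c0 ca; have q0 : 0 < q by lra.
have qi : 0 <= q^-1 by rewrite invr_ge0 ltW.
have qi1 : q * q^-1 = 1 by rewrite mulfV// gt_eqF.
set eps := expR _; have eps0 : 0 <= eps := expR_ge0 _ => e1.
have eq4 : eps <= 4 * (E / q).
  by apply: le_trans e1 _; rewrite [leRHS]mulrA; exact: ler_wpM2r.
have Eq16 : 16 * (E / q) <= 1.
  by rewrite mulrA ler_pdivrMr// mul1r.
have Eq0 : q^-1 <= E / q by rewrite ler_peMl.
set x := E / q in ca eq4 Eq16 Eq0 *; have x0 : 0 <= x by lra.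
set A0 := Num.sqrt (2 * q ^+ 3 / pi).
have A00 : 0 < A0 by rewrite sqrtr_gt0 divr_gt0 ?mulr_gt0 ?exprn_gt0 ?pi_gt0.
have Aa : A0 * a = Num.sqrt pi.
  rewrite /A0 /a -sqrtrM ?divr_ge0 ?mulr_ge0 ?exprn_ge0 ?(ltW q0) ?pi_ge0//.
  have aux (p : R) : 0 < p -> 2 * q ^+ 3 / p * (p ^+ 2 / (2 * q ^+ 3)) = p.
    by move=> p0; field; rewrite !gt_eqF.
  by rewrite (aux _ (@pi_gt0 R)).
have sp1 : 1 <= Num.sqrt pi :> R.
  by rewrite -[leLHS](@sqrtr1 R) ler_wsqrtr// (le_trans _ (@pi_ge2 R))// ler1n.
have Aq : q <= A0.
  rewrite -(@ler_pXn2r _ 2) ?nnegrE ?(ltW q0) ?(ltW A00)//.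
  rewrite sqr_sqrtr ?divr_ge0 ?mulr_ge0 ?exprn_ge0 ?(ltW q0) ?pi_ge0//.
  rewrite ler_pdivlMr ?pi_gt0//.
  have -> : 2 * q ^+ 3 = q ^+ 2 * (2 * q) by ring.
  by apply: ler_wpM2l; [exact: sqr_ge0|have := pi_le4; lra].
have small : 0 <= 1 - 2 * eps - x by lra.
have L1 : A0 * (1 - 2 * eps - x) <= (Num.sqrt pi - 2 * eps) / c.
  rewrite ler_pdivlMr//.
  apply: (@le_trans _ _ (A0 * (1 - 2 * eps - x) * (a * (1 + x)))).
    by apply: ler_wpM2l ca; rewrite mulr_ge0// ltW.
  have -> : A0 * (1 - 2 * eps - x) * (a * (1 + x)) =
    A0 * a * (1 - 2 * eps - 2 * (eps * x) - x ^+ 2) by ring.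
  rewrite Aa.
  apply: (@le_trans _ _ (Num.sqrt pi * (1 - 2 * eps))).
    apply: ler_wpM2l; first lra.
    by have := mulr_ge0 eps0 x0; have := sqr_ge0 x; lra.
  have : 1 * eps <= Num.sqrt pi * eps by rewrite ler_wpM2r.
  lra.
have A1 : 1 <= A0 * x.
  by apply: le_trans (ler_wpM2l (ltW A00) Eq0); rewrite -qi1 ler_wpM2r.
have A2 : A0 * eps <= A0 * (4 * x) by rewrite ler_wpM2l// ltW.
rewrite -mulrA -/x; lra.
Qed.

(** [J] is $q^2/128$ rounded down: degrees below [2 * J] then satisfy $2\pi d/q^2 \le 1/8$, as $\pi
    \le 4$. [D] is a quarter of [J] rounded down, and [F] leaves room for the rounding. *)
Lemma kernel_parameters q F : F = 256 -> 1000 <= q -> exists J D : nat,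
  [/\ J%:R <= q ^+ 2 / 128, q ^+ 2 / F <= J%:R, (4 * D <= J)%N & q ^+ 2 / (8 * F) <= D%:R].
Proof.
move=> FE qbig; have q2big : 3000 <= q ^+ 2 by nra.
have /andP[h1 h2] := truncn_itv (divr_ge0 (sqr_ge0 q) (ler0n R 128)).
move: (Num.truncn _) h1 h2 => J h1; rewrite -[J.+1%:R]natr1 => h2.
exists J; have [D DJ D1] : exists2 D, (4 * D <= J)%N & (J <= 4 * D + 3)%N.
  by move: (J) => J'; clear; exists (J' %/ 4)%N; lia.
exists D; split => //; first by rewrite FE; lra.
move: D1; rewrite -(ler_nat R) natrD natrM FE; lra.
Qed.

(* [u = (2 pi d / k n) * q * n] is the frequency measured in units of [1 / (q n)]. *)
Definition kernel_estimate (C1 : R) : Prop :=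
  forall (k n : nat) (q s B Q : R) (r : nat -> R), q ^+ 3 = k%:R -> C1 <= q ->
  (0 < n)%N -> 0 <= Q ->
  (forall i, 0 <= r i <= B) ->
  (forall (d : nat) u, u = 2 * pi * d%:R / q ^+ 2 -> u <= 8^-1 ->
     Q * expR (- (q * u ^+ 2 / 8 + 5 * u ^+ 2)) <=
     \sum_(0 <= i < k * n) r i * cos (d%:R * (2 * pi / (k * n)%:R) * (i%:R + s))) ->
  Q * (1 - C1 / q) <= B * (n%:R * Num.sqrt (pi * k%:R / 2)).

Lemma kernel_estimate_exists : exists2 C1 : R, 1 <= C1 & kernel_estimate C1.
Proof.
(* Naming the numeral keeps its powers symbolic. *)
have [F FE] : exists F : R, F = 256 by exists 256.
have F0 : 0 < F by rewrite FE ltr0n.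
have [E E1 E2] : exists2 E : R, 320 + 12 * (F * F) <= E & (8 * F) * (8 * F) <= 4 * E.
  by exists (320 + 16 * (F * F)); have := mulr_gt0 F0 F0; lra.
have E0 : 320 <= E by have := mulr_gt0 F0 F0; lra.
exists (16 * E); first lra.
move=> k n q s B Q r qk qC n0 Q0 rB rQ.
have q0 : 0 < q by lra.
have qbig : 1000 <= q by lra.
have [J [D [J1 J2 DJ D2]]] := kernel_parameters FE qbig.
have q20 : 0 < q ^+ 2 by rewrite exprn_gt0.
have J0 : (0 < J)%N by rewrite -(ltr0n R); apply: lt_le_trans J2; rewrite divr_gt0.
have [agt0 ac ca] := kernel_width_bounds q0 F0 J2 E1.
set kap : R := (q / 8 + 5) * (2 * pi / q ^+ 2) ^+ 2 in ac ca.
set c := Num.sqrt (kap + 12 / J%:R ^+ 2) in ac ca.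
have cgt0 : 0 < c by apply: lt_le_trans ac.
have cE : c ^+ 2 = kap + 12 / J%:R ^+ 2.
  by rewrite sqr_sqrtr// ltW// -sqrtr_gt0.
have Fq : (8 * F) * (8 * F) <= q by lra.
have [Dc1 epsub] := kernel_tail_bound q0 F0 D2 ac Fq.
have JM : (J.*2 <= k * n)%N.
  apply: (@leq_trans k); last by rewrite leq_pmulr.
  rewrite -(ler_nat R) -qk -mul2n natrM.
  have q3 : q ^+ 2 * 1 <= q ^+ 3 by rewrite [leRHS]exprSr ler_wpM2l ?(ltW q20)//; lra.
  by clear -J1 q3 q20; lra.
have [K] : Q * ((Num.sqrt pi - 2 * expR (- (D%:R * c))) / c - 1) <= B * (k * n)%:R.
  apply: (@jackson_kernel_bound R (k * n) J D s B Q kap c r) => // d dJ.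
  have := rQ d (2 * pi * d%:R / q ^+ 2) erefl.
  have -> : q * (2 * pi * d%:R / q ^+ 2) ^+ 2 / 8 + 5 * (2 * pi * d%:R / q ^+ 2) ^+ 2 =
     kap * d%:R ^+ 2 by rewrite /kap; ring.
  apply; rewrite ler_pdivrMr//.
  have d2 : d%:R <= 2 * J%:R :> R by rewrite -natrM ler_nat mul2n ltnW.
  apply: (@le_trans _ _ (2 * 4 * (2 * J%:R))); last by clear -J1; lra.
  by apply: ler_pM => //; rewrite ?mulr_ge0 ?pi_ge0// ler_wpM2l// pi_le4.
have E1' : 1 <= E by lra.
have L2 := kernel_constant_bound qC E2 E1' cgt0 ca epsub.
set A0 := Num.sqrt (2 * q ^+ 3 / pi) in L2.
have A00 : 0 < A0 by rewrite sqrtr_gt0 divr_gt0 ?mulr_gt0 ?exprn_gt0 ?pi_gt0.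
have AS : A0 * Num.sqrt (pi * k%:R / 2) = q ^+ 3.
  rewrite /A0 -sqrtrM ?divr_ge0 ?mulr_ge0 ?exprn_ge0 ?(ltW q0) ?pi_ge0//.
  rewrite -qk -[RHS]ger0_norm ?exprn_ge0 ?(ltW q0)// -sqrtr_sqr.
  have aux (p : R) : 0 < p -> 2 * q ^+ 3 / p * (p * q ^+ 3 / 2) = (q ^+ 3) ^+ 2.
    by move=> p0; field; rewrite gt_eqF.
  by rewrite (aux _ (@pi_gt0 R)).
rewrite -(ler_pM2l A00).
have -> : A0 * (B * (n%:R * Num.sqrt (pi * k%:R / 2))) = B * (k * n)%:R.
  transitivity (B * (n%:R * (A0 * Num.sqrt (pi * k%:R / 2)))); first by ring.
  by rewrite AS qk natrM; ring.
by apply: le_trans K; rewrite mulrCA; apply: ler_wpM2l Q0 _ _ L2.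
Qed.

End KernelEstimate.

(** * Random signs *)

Section RandomSigns.
Context {R : realType} {T : finType}.

Lemma sum_signs_tail (z : T -> R) (V t : R) : 0 < V -> 0 <= t ->
  \sum_x z x ^+ 2 <= V ->
  \sum_(sg : {ffun T -> bool}) ((t < `|\sum_x rad (sg x) * z x|)%R)%:R <=
  2 ^+ #|T| * (2 * expR (- (t ^+ 2 / (8 * V)))) :> R.
Proof.
(* This [lam] minimises the Chernoff exponent $2\lambda^2 V - \lambda t$. *)
move=> V0 t0 zV; set lam := t / (4 * V).
have lam0 : 0 <= lam by rewrite divr_ge0// mulr_ge0// ltW.
have mgf (c : R) : \sum_(sg : {ffun T -> bool}) expR (c * \sum_x rad (sg x) * z x) <=
    2 ^+ #|T| * expR (2 * c ^+ 2 * V).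
  have -> : \sum_(sg : {ffun T -> bool}) expR (c * \sum_x rad (sg x) * z x) =
      \prod_x \sum_(b : bool) expR (c * (rad b * z x)).
    rewrite bigA_distr_bigA/=; apply: eq_bigr => sg _.
    by rewrite mulr_sumr expR_sum.
  rewrite -prodr_const; apply: (@le_trans _ _ (\prod_x (2 * expR (2 * (c * z x) ^+ 2)))).
    apply: ler_prod => x _; rewrite big_bool/= /rad /onside/= addr_ge0 ?expR_ge0//=.
    have := cosh_le (c * z x).
    have -> : c * ((2 - 1) * z x) = c * z x by ring.
    have -> : c * ((0 - 1) * z x) = - (c * z x) by ring.
    lra.
  rewrite big_split/= ler_wpM2l ?prodr_ge0// -expR_sum ler_expR.
  have -> : \sum_x 2 * (c * z x) ^+ 2 = 2 * c ^+ 2 * \sum_x z x ^+ 2.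
    by rewrite mulr_sumr; apply: eq_bigr => x _; ring.
  by rewrite ler_wpM2l// mulr_ge0 ?sqr_ge0.
apply: (@le_trans _ _ (\sum_(sg : {ffun T -> bool}) expR (- (lam * t)) *
   (expR (lam * \sum_x rad (sg x) * z x) + expR (- lam * \sum_x rad (sg x) * z x)))).
  apply: ler_sum => sg _; set S := \sum_x _.
  have e1 := expR_ge0 (lam * S); have e2 := expR_ge0 (- lam * S).
  case: ltP => [tS|_]; last by rewrite mulr_ge0 ?expR_ge0// addr_ge0.
  rewrite mulrDr -!expRD -[true%:R]/(1 : R).
  have [S0|/ltW S0] := leP 0 S.
    rewrite ger0_norm// in tS.
    have : 1 <= expR (- (lam * t) + lam * S).
      have := expR_ge1Dx (- (lam * t) + lam * S); have : lam * t <= lam * S by rewrite ler_wpM2l// ltW.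
      by lra.
    by have := expR_ge0 (- (lam * t) + - lam * S); lra.
  rewrite ler0_norm// in tS.
  have : 1 <= expR (- (lam * t) + - lam * S).
    have := expR_ge1Dx (- (lam * t) + - lam * S); have : lam * t <= lam * - S by rewrite ler_wpM2l// ltW.
    by lra.
  by have := expR_ge0 (- (lam * t) + lam * S); lra.
rewrite -mulr_sumr big_split/=.
apply: (@le_trans _ _ (expR (- (lam * t)) * (2 ^+ #|T| * expR (2 * lam ^+ 2 * V) +
   2 ^+ #|T| * expR (2 * lam ^+ 2 * V)))).
  rewrite ler_wpM2l ?expR_ge0// lerD//; apply: le_trans (mgf _) _ => //.
  by rewrite sqrrN.
have -> : expR (- (t ^+ 2 / (8 * V))) = expR (- (lam * t)) * expR (2 * lam ^+ 2 * V).
  by rewrite -expRD; congr expR; rewrite /lam; field; rewrite gt_eqF.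
by rewrite le_eqVlt; apply/orP; left; apply/eqP; ring.
Qed.

End RandomSigns.

(** * Windows of $kn$ consecutive values that contain all sums *)

Section Windows.
Context {R : numDomainType}.

Lemma sum_window (m : int) (D : int) (M : nat) (F : nat -> R) :
  m <= D -> D < m + M%:Z ->
  \sum_(0 <= i < M) (D == m + i%:Z)%:R * F i = F `|D - m|%N.
Proof.
move=> mD DM; rewrite (bigD1_seq `|D - m|%N) ?iota_uniq ?mem_index_iota//=; last by lia.
have -> : (D == m + `|D - m|%N%:Z) = true by apply/eqP; lia.
rewrite mul1r big1_seq ?addr0// => i /andP[ine _].
have [e|_] := eqVneq D (m + i%:Z); last by rewrite mul0r.
by move: ine; rewrite e addrAC subrr add0r absz_nat eqxx.
Qed.

Lemma natr_absB (m D : int) : m <= D -> `|D - m|%N%:R = (D - m)%:~R :> R.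
Proof. by move=> mD; rewrite pmulrn gez0_abs// subr_ge0. Qed.

Lemma diff_window (a b n : nat) (X Z : int) : (0 < n)%N -> (0 < a + b)%N ->
  a%:Z <= X <= (a * n)%:Z -> b%:Z <= Z <= (b * n)%:Z ->
  (a%:Z - (b * n)%:Z <= X - Z) && (X - Z < a%:Z - (b * n)%:Z + ((a + b) * n)%:Z).
Proof.
move=> n0 ab0 /andP[h1 h2] /andP[h3 h4]; rewrite mulnDl PoszD; apply/andP; split; first lia.
have : (0 < a \/ 0 < b)%N by lia.
lia.
Qed.

End Windows.

(** * Representation counts *)

Section SidonCounts.
Context {R : realType} {T : finType}.

Lemma arrangements_le a (s : seq T) : size s = a -> (arrangements (words a) s <= a`!)%N.
Proof.
move=> sa; rewrite -(ler_nat R); apply: le_trans (excess_arrangements sa).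
rewrite ler_peMl//; apply: (big_ind (fun z : R => 1 <= z)) => //.
  by move=> z1 z2 h1 h2; exact: mulr_ege1.
by move=> t _; apply: exprn_ege1; rewrite ler1n.
Qed.

Lemma perm_eq_map_words (f : T -> int) a (s : seq int) : injective f ->
  \sum_(w <- words a) (perm_eq [seq f t | t <- w] s)%:R <= a`!%:R :> R.
Proof.
move=> fi.
have [/hasP[w0 w0a p0]|no] := boolP (has (fun w => perm_eq [seq f t | t <- w] s) (words a)).
  have h : (arrangements (words a) w0)%:R <= a`!%:R :> R.
    by rewrite ler_nat arrangements_le// (size_words w0a).
  apply: le_trans h; rewrite natr_arrangements le_eqVlt; apply/orP; left; apply/eqP.
  apply: eq_bigr => w _.
  have /permPr <- := p0; congr (_ (nat_of_bool _)).
  by apply/idP/idP; [exact: perm_map_inj|exact: perm_map].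
rewrite big_seq big1// => w wa; case: (boolP (perm_eq _ _)) => // p.
by case/negP: no; apply/hasP; exists w.
Qed.

Lemma bkg_sum_words (k g : nat) (A : set int) (f : T -> int) (m : int) :
  injective f -> (forall t, A (f t)) -> is_Bkg k g A ->
  \sum_(w <- words k) ((\sum_(t <- w) f t == m)%:R : R) <= k`!%:R * g%:R.
Proof.
move=> fi fA /(_ m) Sg; set S := ksum_msets k A m in Sg.
have Sfin : finite_set S by apply: card_le_finite Sg _; exact: finite_II.
have Lg : (#|` fset_set S| <= g)%N by exact: geq_card_fset_set.
have h : \sum_(w <- words k) ((\sum_(t <- w) f t == m)%:R : R) <=
    \sum_(w <- words k) \sum_(X <- fset_set S) ((perm_eq [seq f t | t <- w] (X : {mset int}%mset))%:R : R).
  rewrite big_seq [leRHS]big_seq; apply: ler_sum => w wk.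
  have [e|_] := eqVneq (\sum_(t <- w) f t) m; last by rewrite sumr_ge0.
  set X := seq_mset [seq f t | t <- w].
  have pX : perm_eq X [seq f t | t <- w] by exact: perm_eq_seq_mset.
  have XS : X \in fset_set S.
    rewrite in_fset_set// inE; split.
    - by rewrite (perm_size pX) size_map (size_words wk).
    - by move=> x; rewrite (perm_mem pX) => /mapP[t _ ->].
    - by rewrite (perm_big _ pX)/= big_map.
  rewrite (big_fsetD1 X XS)/= perm_sym pX lerDl; exact: sumr_ge0.
apply: le_trans h _; rewrite exchange_big/=.
apply: (@le_trans _ _ (\sum_(X <- fset_set S) (k`!%:R : R))).
  by apply: ler_sum => X _; exact: perm_eq_map_words.
by rewrite big_const_seq count_predT iter_addr addr0 -[leLHS]mulr_natr ler_wpM2l// ler_nat.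
Qed.

(** Exchanging the negative parts turns equal differences into equal sums of [x ++ y'] and
    [x' ++ y], which the $B_k$ property identifies. Disjointness then recovers the two
    multiplicities of each letter as the positive and negative parts of their difference. *)
Lemma b1_disjoint_words_uniq (a b : nat) (A : set int) (f : T -> int) (x y x' y' : seq T) :
  injective f -> (forall t, A (f t)) -> is_Bkg (a + b) 1 A ->
  size x = a -> size y = b -> size x' = a -> size y' = b ->
  ~~ has (mem x) y -> ~~ has (mem x') y' ->
  \sum_(t <- x) f t - \sum_(t <- y) f t = \sum_(t <- x') f t - \sum_(t <- y') f t ->
  perm_eq x x' /\ perm_eq y y'.
Proof.
move=> fi fA B sx sy sx' sy' d d' e.
pose m := \sum_(t <- x ++ y') f t.
have inS (w : seq T) : size w = (a + b)%N -> \sum_(t <- w) f t = m ->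
    ksum_msets (a + b) A m (seq_mset [seq f t | t <- w]).
  move=> sw wm; have pX := perm_eq_seq_mset [seq f t | t <- w].
  split.
  - by rewrite (perm_size pX) size_map.
  - by move=> z; rewrite (perm_mem pX) => /mapP[t _ ->].
  - by rewrite (perm_big _ pX)/= big_map.
have S1 := inS (x ++ y'); have S2 := inS (x' ++ y).
have {}S1 : ksum_msets (a + b) A m (seq_mset [seq f t | t <- x ++ y']).
  by apply: S1 => //; rewrite size_cat sx sy'.
have {}S2 : ksum_msets (a + b) A m (seq_mset [seq f t | t <- x' ++ y]).
  apply: S2; first by rewrite size_cat sx' sy.
  rewrite /m !big_cat/=; move: e.
  move: (\sum_(t <- x) f t) (\sum_(t <- y) f t) (\sum_(t <- x') f t) (\sum_(t <- y') f t).
  by clear; lia.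
have E : seq_mset [seq f t | t <- x ++ y'] = seq_mset [seq f t | t <- x' ++ y].
  have /card_leP[h] := B m.
  have hv (u : set_type (ksum_msets (a + b) A m)) : val (h u) = 0%N.
    have : (`I_1 : set nat) (val (h u)) by apply: set_valP.
    by rewrite /=; lia.
  pose u1 : set_type (ksum_msets (a + b) A m) := SigSub (mem_set S1).
  pose u2 : set_type (ksum_msets (a + b) A m) := SigSub (mem_set S2).
  have : u1 = u2 by apply: (@inj _ _ setT h); rewrite ?inE//; apply/val_inj; rewrite !hv.
  by move=> /(congr1 val).
have P : perm_eq (x ++ y') (x' ++ y).
  by apply: (perm_map_inj fi); apply/eq_seq_msetP.
have C t : (count_mem t x + count_mem t y' = count_mem t x' + count_mem t y)%N.
  by have /permP/(_ (pred1 t)) := P; rewrite !count_cat.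
have D (u v : seq T) t : ~~ has (mem u) v -> (count_mem t u = 0 \/ count_mem t v = 0)%N.
  move=> uv; have [tu|/count_memPn] := boolP (t \in u); last by left.
  right; apply/count_memPn; apply: contra uv => tv; by apply/hasP; exists t.
split; apply/allP => t _; apply/eqP; move: (C t) (D x y t d) (D x' y' t d') => /=.
  by clear; lia.
by clear; lia.
Qed.

End SidonCounts.

(** * Density bounds *)

Lemma sum_range (T : Type) (f : T -> int) (n : nat) (w : seq T) :
  (forall t, 1 <= f t <= n%:Z) ->
  (size w)%:Z <= \sum_(t <- w) f t <= (size w * n)%:Z.
Proof.
move=> f_range; elim: w => [|t w IH]; first by rewrite big_nil mul0n.
have /andP[h1 h2] := IH; have /andP[h3 h4] := f_range t.
rewrite big_cons/= mulSn PoszD -addn1 PoszD.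
move: (\sum_(t <- w) f t) h1 h2 => S h1 h2.
by apply/andP; split; [rewrite addrC; exact: lerD|exact: lerD].
Qed.

Section MainBounds.
Context {R : realType} {T : finType}.
Variables (f : T -> int) (n : nat).
Hypothesis f_inj : injective f.
Hypothesis f_range : forall t, 1 <= f t <= n%:Z.
Hypothesis T_gt0 : (0 < #|T|)%N.
Let N : R := #|T|%:R.
Let mu : R := (\sum_t (f t)%:~R) / N.
Let y (t : T) : R := (f t)%:~R - mu.

Let N0 : 0 < N. Proof. by rewrite ltr0n. Qed.
Let n_gt0 : (0 < n)%N.
Proof. by have /card_gt0P[t _] := T_gt0; have := f_range t; lia. Qed.
Let nR0 : 0 < n%:R :> R. Proof. by rewrite ltr0n. Qed.

Let fR t : 1 <= ((f t)%:~R : R) <= n%:R.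
Proof.
have /andP[h1 h2] := f_range t.
by rewrite -[1](mulr1z 1) ler_int h1 /= pmulrn ler_int.
Qed.

Let mu_range : 1 <= mu <= n%:R.
Proof.
have e (x : R) : \sum_(t : T) x = x * N by rewrite sumr_const mulr_natr.
rewrite /mu ler_pdivlMr// ler_pdivrMr// -!e.
by apply/andP; split; apply: ler_sum => t _; have /andP[] := fR t.
Qed.

Let y_le t : `|y t| <= n%:R.
Proof.
have /andP[h1 h2] := fR t; have /andP[h3 h4] := mu_range.
by rewrite /y ler_norml; apply/andP; split; lra.
Qed.

Let y_mean : \sum_t y t = 0.
Proof.
by rewrite sumrB sumr_const -[mu *+ _]mulr_natr divfK ?subrr// gt_eqF.
Qed.

(** The mean square is smallest about the mean, so it may be taken about the midpoint [c] of the
    interval, where every deviation is at most $(n-1)/2$. *)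
Let y_var : \sum_t y t ^+ 2 <= N * (n%:R ^+ 2 / 4).
Proof.
set c : R := (n%:R + 1) / 2.
have -> : \sum_t y t ^+ 2 = \sum_t (((f t)%:~R - c) ^+ 2) - N * (mu - c) ^+ 2.
  have -> : N * (mu - c) ^+ 2 = \sum_(t : T) (mu - c) ^+ 2 + 2 * (mu - c) * \sum_t y t.
    by rewrite y_mean mulr0 addr0 sumr_const mulr_natl.
  rewrite mulr_sumr -big_split/= -sumrB; apply: eq_bigr => t _.
  by rewrite /y; ring.
rewrite lerBlDr; apply: (@le_trans _ _ (\sum_(t : T) n%:R ^+ 2 / 4)).
  apply: ler_sum => t _; have /andP[h1 h2] := fR t.
  have := mulr_ge0 (_ : 0 <= (f t)%:~R - 1 :> R) (_ : 0 <= n%:R - (f t)%:~R :> R).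
  rewrite !subr_ge0 => /(_ h1 h2); rewrite /c; have : (1 : R) <= n%:R by rewrite ler1n.
  by nra.
rewrite sumr_const -[leLHS]mulr_natl lerDl mulr_ge0 ?sqr_ge0//; exact: ltW.
Qed.

Let sum_y (c : R) (w : seq T) :
  \sum_(t <- w) c * y t = c * ((\sum_(t <- w) f t)%:~R - (size w)%:R * mu).
Proof.
elim: w => [|t w IH]; first by rewrite !big_nil /= mul0r subr0 mulr0z mulr0.
by rewrite !big_cons IH /= intrD -[(size w).+1%:R]natr1 /y; ring.
Qed.

Variables (k : nat) (q : R).
Hypothesis qk : q ^+ 3 = k%:R.
Hypothesis q1 : 1 <= q.

Let q0 : 0 < q. Proof. exact: lt_le_trans q1. Qed.

Let freqE (u : R) (d : nat) : u = 2 * pi * d%:R / q ^+ 2 ->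
  d%:R * (2 * pi / (k * n)%:R) = u / q / n%:R.
Proof. by move=> ->; rewrite natrM -qk; field; rewrite !gt_eqF. Qed.

(** [r i] counts the words with sum [k + i]. The shift [k - k * mu] of the grid recentres the phases
    at the mean. *)
Lemma bkg_density_bound (C1 : R) (g : nat) (A : set int) :
  kernel_estimate C1 ->
  C1 <= q -> (forall t, A (f t)) -> is_Bkg k g A ->
  N ^+ k * (1 - C1 / q) <= k`!%:R * g%:R * (n%:R * Num.sqrt (pi * k%:R / 2)).
Proof.
move=> KC Cq fA Bk.
pose r (i : nat) : R := \sum_(w <- words k) (\sum_(t <- w) f t == k%:Z + i%:Z)%:R.
apply: (KC k n q (k%:R - k%:R * mu) _ _ r) => //; first by rewrite exprn_ge0// ltW.
  by move=> i; rewrite sumr_ge0//= /r; apply: bkg_sum_words Bk.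
move=> d u uE u8; have u0 : 0 <= u.
  by rewrite uE; apply: divr_ge0 (sqr_ge0 _); do 2!(apply: mulr_ge0 => //); exact: pi_ge0.
rewrite (freqE uE).
have -> : \sum_(0 <= i < k * n) r i * cos (u / q / n%:R * (i%:R + (k%:R - k%:R * mu))) =
   \sum_(w <- words k) cos (\sum_(t <- w) u / q / n%:R * y t).
  rewrite /r; under eq_bigr do rewrite mulr_suml.
  rewrite exchange_big/= big_seq [RHS]big_seq; apply: eq_bigr => w wk.
  have sw := size_words wk; have /andP[h1 h2] := sum_range w f_range; rewrite sw in h1 h2.
  have k0 : (0 < k)%N by rewrite -(ltr0n R) -qk exprn_gt0.
  have h3 : \sum_(t <- w) f t < k%:Z + (k * n)%:Z.
    by apply: le_lt_trans h2 _; rewrite ltrDr ltz_nat.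
  rewrite (sum_window (m := k%:Z))//.
  rewrite sum_y sw; congr cos; congr (_ * _).
  rewrite natr_absB//.
  by rewrite intrB -pmulrn; ring.
exact: (@words_charfun_ge R T y n%:R nR0 y_le y_mean y_var k q u qk q1 u0 u8).
Qed.

Variables (a b : nat) (A : set int).
Hypothesis ab : (a = b \/ a = b.+1) /\ (a + b)%N = k.
Hypothesis fA : forall t, A (f t).
Hypothesis b1A : is_Bkg k 1 A.

Let diff (x z : seq T) : int := \sum_(t <- x) f t - \sum_(t <- z) f t.

Let signed_count_le (m : int) :
  \sum_sg \sum_(x <- words a) \sum_(z <- words b)
     sign_weight sg x z * (diff x z == m)%:R <= 2 ^+ #|T| * (a`!%:R * b`!%:R) :> R.
Proof.
have [_ abk] := ab.
apply: sum_signed_words_le => //.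
- move=> x z x' z' /size_words sx /size_words sz /size_words sx' /size_words sz'.
  by move: b1A; rewrite -abk => b1; apply: (b1_disjoint_words_uniq f_inj fA b1).
- by move=> s /size_words; exact: excess_arrangements.
- by move=> s /size_words; exact: excess_arrangements.
Qed.

Let w := q^-1.
(** A relative imbalance $\delta$, in size or in mean, is tolerable up to order $w^2 = k^{-2/3}$: in
    size it costs about $k\delta^2$ in the exponent, and $k w^4 = w$. *)
Let good (sg : {ffun T -> bool}) :=
  (`|\sum_t rad (sg t)| <= N * (8^-1 * w ^+ 2)) &&
  (`|\sum_t rad (sg t) * y t| <= N * (n%:R * (8^-1 * w ^+ 2))).

Let sum_good : 2 ^+ #|T| * (1 - 4 * expR (- (N * w ^+ 4 / 512))) <= \sum_sg ((good sg)%:R : R).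
Proof.
set e := expR _.
have w20 : 0 <= 8^-1 * w ^+ 2 by rewrite mulr_ge0 ?sqr_ge0.
set t1 := N * (8^-1 * w ^+ 2); set t2 := N * (n%:R * (8^-1 * w ^+ 2)).
have t10 : 0 <= t1 by rewrite mulr_ge0.
have t20 : 0 <= t2 by apply: mulr_ge0; [exact: ltW|exact: mulr_ge0].
have V2 : 0 < N * n%:R ^+ 2 by rewrite mulr_gt0 ?exprn_gt0.
have V1 : \sum_(t : T) (1 : R) ^+ 2 <= N.
  by rewrite expr1n sumr_const.
have V3 : \sum_t y t ^+ 2 <= N * n%:R ^+ 2.
  apply: le_trans y_var _; rewrite ler_wpM2l// ?(ltW N0)//.
  by have := sqr_ge0 (n%:R : R); lra.
have B1 := sum_signs_tail N0 t10 V1; have B2 := sum_signs_tail V2 t20 V3.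
have e1 : t1 ^+ 2 / (8 * N) = N * w ^+ 4 / 512 by rewrite /t1; field; rewrite gt_eqF.
have e2 : t2 ^+ 2 / (8 * (N * n%:R ^+ 2)) = N * w ^+ 4 / 512.
  by rewrite /t2; field; rewrite !gt_eqF.
rewrite e1 -/e in B1; rewrite e2 -/e in B2.
have tot : \sum_(sg : {ffun T -> bool}) (1 : R) = 2 ^+ #|T|.
  by rewrite sumr_const card_ffun card_bool natrX.
have -> : 2 ^+ #|T| * (1 - 4 * e) = 2 ^+ #|T| - 2 ^+ #|T| * (2 * e) - 2 ^+ #|T| * (2 * e) by ring.
apply: le_trans (lerB (lerB (lexx _) B1) B2) _.
rewrite -tot -!sumrB; apply: ler_sum => sg _.
under [\sum_x rad (sg x) * 1]eq_bigr do rewrite mulr1.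
rewrite /good -/t1 -/t2 (leNgt _ t1) (leNgt _ t2).
set p1 := t1 < _; set p2 := t2 < _.
by case: p1; case: p2; rewrite /= ?mulr1n ?mulr0n; lra.
Qed.

(** Only good splittings enter [r], so each of them satisfies the lower bound for the characteristic
    function. In the upper bound the indicator is dropped by nonnegativity, because uniqueness is
    exploited only on average over all splittings. *)
Lemma sidon_density_bound (C1 : R) : kernel_estimate C1 -> C1 <= q ->
  N ^+ k * expR (- w) * (1 - 4 * expR (- (N * w ^+ 4 / 512))) * (1 - C1 / q) <=
  a`!%:R * b`!%:R * (n%:R * Num.sqrt (pi * k%:R / 2)).
Proof.
move=> KC Cq; have [ab1 abk] := ab.
have two0 : 0 < 2 ^+ #|T| :> R by rewrite exprn_gt0.
have Nk0 : 0 <= N ^+ k * expR (- w) by rewrite mulr_ge0 ?expR_ge0// exprn_ge0// ltW.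
pose m0 : int := a%:Z - (b * n)%:Z.
pose r (i : nat) : R := \sum_sg \sum_(x <- words a) \sum_(z <- words b)
  (good sg)%:R * sign_weight sg x z * (diff x z == m0 + i%:Z)%:R.
have sw0 sg x z : 0 <= sign_weight sg x z :> R.
  by rewrite mulr_ge0// prodr_ge0// => t _; rewrite /onside; case: ifP.
pose Q : R := N ^+ k * expR (- w) * \sum_sg (good sg)%:R.
have Q0 : 0 <= Q by rewrite mulr_ge0// sumr_ge0.
have r_le i : 0 <= r i <= 2 ^+ #|T| * (a`!%:R * b`!%:R).
  apply/andP; split.
    by do 3!(apply: sumr_ge0 => ? _); do 2!(apply: mulr_ge0 => //).
  apply: le_trans (signed_count_le (m0 + i%:Z)).
  do 3!(apply: ler_sum => ? _); rewrite ler_wpM2r// ler_piMl//.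
  by case: (good _).
have key : Q * (1 - C1 / q) <= 2 ^+ #|T| * (a`!%:R * b`!%:R) * (n%:R * Num.sqrt (pi * k%:R / 2)).
  apply: (KC k n q (m0%:~R - (a%:R - b%:R) * mu) _ _ r) => //.
  move=> d u uE u8; have u0 : 0 <= u.
    by rewrite uE; apply: divr_ge0 (sqr_ge0 _); do 2!(apply: mulr_ge0 => //); exact: pi_ge0.
  rewrite (freqE uE); set c := u / q / n%:R.
  have -> : \sum_(0 <= i < k * n) r i * cos (c * (i%:R + (m0%:~R - (a%:R - b%:R) * mu))) =
     \sum_sg (good sg)%:R * \sum_(x <- words a) \sum_(z <- words b)
       sign_weight sg x z * cos (\sum_(t <- x) c * y t - \sum_(t <- z) c * y t).
    rewrite /r; under eq_bigr do rewrite mulr_suml.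
    rewrite exchange_big/=; apply: eq_bigr => sg _.
    under eq_bigr do rewrite mulr_suml.
    rewrite exchange_big/= mulr_sumr big_seq [RHS]big_seq; apply: eq_bigr => x /size_words xa.
    under eq_bigr do rewrite mulr_suml.
    rewrite exchange_big/= mulr_sumr big_seq [RHS]big_seq; apply: eq_bigr => z /size_words zb.
    under eq_bigr do rewrite -[_ * _ * cos _]mulrA.
    rewrite -mulr_sumr [RHS]mulrA; congr (_ * _).
    have k0 : (0 < a + b)%N by rewrite abk -(ltr0n R) -qk exprn_gt0.
    have sx := sum_range x f_range; have sz := sum_range z f_range; rewrite xa in sx; rewrite zb in sz.
    have /andP[d1 d2] := diff_window n_gt0 k0 sx sz.
    rewrite abk in d2; rewrite (sum_window (m := m0))// natr_absB//.
    by congr cos; rewrite !sum_y xa zb /diff !intrB; ring.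
  rewrite /Q -mulrA [_ * expR (- (q * _ / 8 + _))]mulrC mulrA mulr_sumr.
  apply: ler_sum => sg _; rewrite mulrC.
  have [/andP[g1 g2]|_] := boolP (good sg); last by rewrite !mul0r.
  rewrite !mul1r.
  exact: (@signed_words_charfun_ge R T y n%:R nR0 y_le y_mean y_var k q u qk q1 u0 u8 sg a b ab g1 g2).
have C1q : 0 <= 1 - C1 / q by rewrite subr_ge0 ler_pdivrMr// mul1r.
rewrite -(ler_pM2l two0) [leRHS]mulrA.
have := ler_wpM2r C1q (ler_wpM2l Nk0 sum_good).
rewrite -/Q => /le_trans/(_ key); apply: le_trans.
by rewrite le_eqVlt; apply/orP; left; apply/eqP; ring.
Qed.

End MainBounds.

(** * Bounds by the trivial count of values, plain and with tripled letters *)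

Section CrudeBounds.
Context {R : realType} {T : finType}.
Variables (f : T -> int) (n : nat).
Hypothesis f_inj : injective f.
Hypothesis f_range : forall t, 1 <= f t <= n%:Z.
Let N : R := #|T|%:R.

Lemma bkg_crude_bound (k g : nat) (A : set int) : (0 < k)%N -> (0 < n)%N ->
  (forall t, A (f t)) -> is_Bkg k g A ->
  N ^+ k <= k`!%:R * g%:R * (k * n)%:R.
Proof.
move=> k0 n0 fA Bk.
have -> : N ^+ k = \sum_(0 <= i < k * n) \sum_(w <- words k)
    (\sum_(t <- w) f t == k%:Z + i%:Z)%:R.
  have -> : N = \sum_(t : T) 1 by rewrite sumr_const.
  rewrite -sum_words_prod exchange_big/= big_seq [RHS]big_seq.
  apply: eq_bigr => w wk; rewrite big1//.
  have /andP[h1 h2] := sum_range w f_range; rewrite (size_words wk) in h1 h2.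
  under eq_bigr do rewrite -[_%:R]mulr1.
  rewrite (@sum_window R k%:Z _ _ (fun=> 1))//.
  by apply: le_lt_trans h2 _; rewrite ltrDr ltz_nat.
apply: (@le_trans _ _ (\sum_(0 <= i < k * n) k`!%:R * g%:R)).
  by apply: ler_sum => i _; exact: bkg_sum_words Bk.
by rewrite sumr_const_nat subn0 -[leLHS]mulr_natr.
Qed.

Variables (a b : nat) (A : set int).
Hypothesis ab : a = b \/ a = b.+1.
Hypothesis fA : forall t, A (f t).
Hypothesis b1A : is_Bkg (a.+3 + b.+3) 1 A.

Let diff (x z : seq T) : int := \sum_(t <- x) f t - \sum_(t <- z) f t.

Let tripled_count_le (m : int) :
  \sum_sg \sum_(x <- tripled_words a) \sum_(z <- tripled_words b)
     sign_weight sg x z * (diff x z == m)%:R <=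
  2 ^+ #|T| * ((16 * a`!%:R) * (16 * b`!%:R)) :> R.
Proof.
apply: sum_signed_words_le.
- move=> x z x' z' /size_tripled_words sx /size_tripled_words sz.
  move=> /size_tripled_words sx' /size_tripled_words sz'.
  exact: (b1_disjoint_words_uniq f_inj fA b1A).
- by move=> s /size_tripled_words; exact: excess_tripled.
- by move=> s /size_tripled_words; exact: excess_tripled.
- by rewrite mulr_ge0.
- by rewrite mulr_ge0.
Qed.

(** As [onside] takes the values 0 and 2, its cube is 4 times itself: a triple behaves like one
    letter with weight 4. *)
Let sum_tripled (c : nat) (h : T -> bool) :
  \sum_(x <- tripled_words c) \prod_(t <- x) onside (h t) =
  4 * (\sum_t onside (h t)) ^+ c.+1 :> R.
Proof.
rewrite big_tripled_words exprS mulrA mulr_sumr mulr_suml; apply: eq_bigr => e _.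
under eq_bigr do rewrite !big_cons !mulrA.
rewrite -mulr_sumr sum_words_prod; congr (_ * _).
by rewrite /onside; case: (h e); ring.
Qed.

Lemma sidon_tripled_bound : (0 < n)%N -> 
  \sum_(sg : {ffun T -> bool}) (N + \sum_t rad (sg t)) ^+ a.+1 *
      (N - \sum_t rad (sg t)) ^+ b.+1 <=
  2 ^+ #|T| * (16 * (a`!%:R * b`!%:R) * ((a.+3 + b.+3) * n)%:R) :> R.
Proof.
move=> n0; set k := (a.+3 + b.+3)%N.
have onE (sg : {ffun T -> bool}) : \sum_t onside (sg t) = N + \sum_t rad (sg t) :> R.
  under eq_bigr do rewrite onsideE.
  by rewrite big_split/= sumr_const.
have onNE (sg : {ffun T -> bool}) : \sum_t onside (~~ sg t) = N - \sum_t rad (sg t) :> R.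
  under eq_bigr do rewrite onsideN.
  by rewrite sumrB sumr_const.
pose m0 : int := a.+3%:Z - (b.+3 * n)%:Z.
have E : \sum_(sg : {ffun T -> bool}) 16 * ((N + \sum_t rad (sg t)) ^+ a.+1 *
      (N - \sum_t rad (sg t)) ^+ b.+1) =
  \sum_(0 <= i < k * n) \sum_sg \sum_(x <- tripled_words a) \sum_(z <- tripled_words b)
     sign_weight sg x z * (diff x z == m0 + i%:Z)%:R.
  rewrite exchange_big/=; apply: eq_bigr => sg _.
  rewrite -onE -onNE.
  have -> : 16 * ((\sum_t onside (sg t)) ^+ a.+1 * (\sum_t onside (~~ sg t)) ^+ b.+1) =
     (4 * (\sum_t onside (sg t)) ^+ a.+1) * (4 * (\sum_t onside (~~ sg t)) ^+ b.+1) :> R.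
    by ring.
  rewrite -(sum_tripled a (fun t => sg t)) -(sum_tripled b (fun t => ~~ sg t)).
  rewrite exchange_big/= mulr_suml big_seq [RHS]big_seq; apply: eq_bigr => x xa.
  rewrite exchange_big/= mulr_sumr big_seq [RHS]big_seq; apply: eq_bigr => z zb.
  rewrite -mulr_sumr -[LHS]mulr1; congr (_ * _).
  have sx := sum_range x f_range; have sz := sum_range z f_range.
  rewrite (size_tripled_words xa) in sx; rewrite (size_tripled_words zb) in sz.
  have k0 : (0 < a.+3 + b.+3)%N by rewrite addSn.
  have /andP[d1 d2] := diff_window n0 k0 sx sz.
  under eq_bigr do rewrite -[_%:R]mulr1.
  by rewrite (@sum_window R m0 _ _ (fun=> 1)).
have p16 : (0 : R) < 16 by rewrite ltr0n.
rewrite -(ler_pM2l p16) mulr_sumr E.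
apply: le_trans (ler_sum _ (fun i _ => tripled_count_le (m0 + i%:Z))) _.
rewrite sumr_const_nat subn0 -[leLHS]mulr_natr le_eqVlt; apply/orP; left; apply/eqP.
by rewrite -/k; ring.
Qed.

Lemma sum_tripled_lb : 128 <= N -> b.+1%:R <= 4 * N ->
  2 ^+ #|T| * (N ^+ (a + b).+2 * (expR (- (64 * 4)) / 4)) <=
  \sum_(sg : {ffun T -> bool}) (N + \sum_t rad (sg t)) ^+ a.+1 *
      (N - \sum_t rad (sg t)) ^+ b.+1 :> R.
Proof.
move=> N128 bN; have N0 : 0 < N by lra.
set E := expR _; have E0 : 0 < E := expR_gt0 _.
(* This makes the tail $2e^{-4} \le 1/2$, so half of the splittings are kept. For these $(N+S)(N-S)
   \ge N^2(1 - 32/N)$, and [b.+1 <= 4 * N] bounds the total loss of the pairs by $e^{-256}$. *)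
pose t := Num.sqrt (32 * N).
have t0 : 0 <= t := sqrtr_ge0 _.
have t2 : t ^+ 2 = 32 * N by rewrite sqr_sqrtr// mulr_ge0// ltW.
have tN : t <= N / 2.
  rewrite -(@ler_pXn2r _ 2) ?nnegrE ?divr_ge0 ?(ltW N0)// t2; nra.
have V1 : \sum_(t : T) (1 : R) ^+ 2 <= N by rewrite expr1n sumr_const.
have tail := sum_signs_tail N0 t0 V1.
have e4 : expR (- (t ^+ 2 / (8 * N))) <= 4^-1.
  have -> : t ^+ 2 / (8 * N) = 4 by rewrite t2; field; rewrite gt_eqF.
  rewrite expRN lef_pV2 ?posrE ?expR_gt0//.
  by have := expR_ge1Dx (4 : R); lra.
have two0 : 0 <= 2 ^+ #|T| :> R by rewrite exprn_ge0.
have half : 2 ^+ #|T| / 2 <= \sum_(sg : {ffun T -> bool})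
    ((`|\sum_t rad (sg t)| <= t)%R)%:R :> R.
  have tot : \sum_(sg : {ffun T -> bool}) (1 : R) = 2 ^+ #|T|.
    by rewrite sumr_const card_ffun card_bool natrX.
  apply: (@le_trans _ _ (2 ^+ #|T| - 2 ^+ #|T| * (2 * expR (- (t ^+ 2 / (8 * N)))))).
    by have := ler_wpM2l two0 e4; lra.
  apply: le_trans (lerB (lexx _) tail) _.
  rewrite -{1}tot -sumrB; apply: ler_sum => sg _.
  under [\sum_x rad (sg x) * 1]eq_bigr do rewrite mulr1.
  by rewrite (leNgt _ t); case: (t < _); rewrite /= ?mulr1n ?mulr0n; lra.
apply: (@le_trans _ _ (\sum_(sg : {ffun T -> bool})
    ((`|\sum_t rad (sg t)| <= t)%R)%:R * (N ^+ (a + b).+2 * (E / 2)))).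
  rewrite -mulr_suml; apply: le_trans (ler_wpM2r _ half); last first.
    by rewrite mulr_ge0 ?exprn_ge0 ?divr_ge0 ?(ltW N0) ?(ltW E0).
  by rewrite le_eqVlt; apply/orP; left; apply/eqP; field.
have radle (sg : {ffun T -> bool}) : `|\sum_t rad (sg t)| <= N :> R.
  apply: le_trans (ler_norm_sum _ _ _) _; have -> : N = \sum_(t : T) 1 by rewrite sumr_const.
  by apply: ler_sum => x _; exact: norm_rad.
apply: ler_sum => sg _; move: (\sum_t rad (sg t)) (radle sg) => S SN.
have [S1 S2] : - N <= S /\ S <= N by move: SN; rewrite ler_norml => /andP[].
have [St|_] := leP `|S| t; last first.
  by rewrite mul0r mulr_ge0// exprn_ge0//; lra.
rewrite mul1r; have SS : S ^+ 2 <= 32 * N.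
  by rewrite -t2 -(real_normK (num_real S)) lerXn2r ?nnegrE.
have [S3 S4] : - t <= S /\ S <= t by move: St; rewrite ler_norml => /andP[].
have prodE : N ^+ 2 * expR (- (2 * (32 / N))) <= (N + S) * (N - S).
  apply: (@le_trans _ _ (N ^+ 2 * (1 - 32 / N))).
    rewrite ler_wpM2l ?sqr_ge0// one_sub_ge_expR2// divr_ge0 ?(ltW N0)//=.
    by rewrite ler_pdivrMr//; lra.
  have -> : N ^+ 2 * (1 - 32 / N) = N ^+ 2 - 32 * N by field; rewrite gt_eqF.
  have -> : (N + S) * (N - S) = N ^+ 2 - S ^+ 2 by ring.
  lra.
have powE : N ^+ (b.+1 + b.+1) * E <= (N + S) ^+ b.+1 * (N - S) ^+ b.+1.
  rewrite -exprMn; apply: (@le_trans _ _ ((N ^+ 2 * expR (- (2 * (32 / N)))) ^+ b.+1)).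
    rewrite exprMn -exprM -expRM_natl addnn -mul2n ler_wpM2l ?exprn_ge0 ?(ltW N0)//.
    rewrite ler_expR mulrN lerN2.
    have -> : b.+1%:R * (2 * (32 / N)) = 64 * (b.+1%:R / N) by ring.
    by rewrite ler_wpM2l// ler_pdivrMr.
  by rewrite lerXn2r ?nnegrE ?mulr_ge0 ?exprn_ge0 ?(ltW N0) ?expR_ge0//; lra.
have P0 : 0 <= (N + S) ^+ b.+1 * (N - S) ^+ b.+1.
  by rewrite mulr_ge0// exprn_ge0//; lra.
have M0 : 0 <= N ^+ (b.+1 + b.+1) * E by rewrite mulr_ge0 ?exprn_ge0 ?(ltW N0) ?(ltW E0).
case: ab => ->.
  have -> : (b + b).+2 = (b.+1 + b.+1)%N by rewrite addSn addnS.
  by move: powE M0; lra.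
have -> : (b.+1 + b).+2 = (b.+1 + b.+1).+1 by rewrite !addSn !addnS.
rewrite [(N + S) ^+ _]exprS [N ^+ _]exprS -[leRHS]mulrA.
apply: (@le_trans _ _ (N / 2 * (N ^+ (b.+1 + b.+1) * E))).
  by rewrite le_eqVlt; apply/orP; left; apply/eqP; field.
apply: ler_pM => //; last lra.
by rewrite divr_ge0 ?(ltW N0).
Qed.

End CrudeBounds.

(** * Assembling the regimes *)

Section Assembly.
Context {R : realType}.

(** From $m^m/m! \le e^m \le 4^m$. *)
Lemma expr_le_fact (N m : nat) : (4 * N <= m)%N -> (N ^ m <= m`!)%N.
Proof.
move=> Nm; rewrite -(ler_nat R) natrX.
case: m Nm => [|m] Nm; first by rewrite expr0.
have e1 : expR (1 : R) <= 4.
  have -> : expR (1 : R) = expR 2^-1 ^+ 2 by rewrite -expRM_natl mulfV.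
  have h : expR (2^-1) <= (2 : R).
    by apply: le_trans (expR_gt_inv _) _; [lra|rewrite (_ : 1 - 2^-1 = 2^-1); [rewrite invrK|field]].
  by have := expR_ge0 (2^-1 : R); nra.
have h := @expR_ge1Dxn R m.+1%:R m (ler0n _ _).
have em : expR (m.+1%:R) <= (4 : R) ^+ m.+1.
  rewrite -[X in expR X]mulr1 expRM_natl lerXn2r ?nnegrE ?expR_ge0//.
have f0 : (0 : R) < m.+1`!%:R by rewrite ltr0n fact_gt0.
have h2 : m.+1%:R ^+ m.+1 <= (4 : R) ^+ m.+1 * m.+1`!%:R.
  by rewrite -ler_pdivrMr//; lra.
have p4 : (0 : R) < 4 ^+ m.+1 by rewrite exprn_gt0.
rewrite -(ler_pM2l p4); apply: le_trans h2; rewrite -exprMn.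
by rewrite lerXn2r ?nnegrE ?mulr_ge0// -natrM ler_nat.
Qed.

Lemma expRN_le_inv8 (x : R) : 0 < x -> expR (- x) <= 8`!%:R / x ^+ 8.
Proof.
move=> x0; have h := @expR_ge1Dxn R x 7 (ltW x0).
have f0 : (0 : R) < 8`!%:R by rewrite ltr0n fact_gt0.
rewrite expRN -[leRHS]invf_div lef_pV2 ?posrE ?expR_gt0 ?divr_gt0 ?exprn_gt0//.
lra.
Qed.

Lemma le_of_mul_sub (z X Y : R) : 0 <= X -> 0 <= z <= 2^-1 ->
  X * (1 - z) <= Y -> X <= Y * (1 + 2 * z).
Proof.
move=> X0 /andP[h1 h2] h; have p : 0 <= 1 + 2 * z by lra.
apply: le_trans (ler_wpM2r p h); rewrite -mulrA; apply: ler_peMr => //.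
have : 0 <= z * (1 - 2 * z) by apply: mulr_ge0 => //; lra.
by lra.
Qed.

Lemma sqrt_pi_half_ge (k : nat) : Num.sqrt k%:R <= Num.sqrt (pi * k%:R / 2) :> R.
Proof.
apply: ler_wsqrtr; rewrite mulrAC ler_peMl//.
by rewrite ler_pdivlMr// mul1r pi_ge2.
Qed.

Lemma sqrt_pi_half_ge1 (k : nat) : (0 < k)%N -> 1 <= Num.sqrt (pi * k%:R / 2) :> R.
Proof.
move=> k0; apply: le_trans (sqrt_pi_half_ge k).
by rewrite -[leLHS](@sqrtr1 R); apply: ler_wsqrtr; rewrite ler1n.
Qed.

(** The term [(2 * C1) ^+ 4] serves the finitely many small [k], where the trivial count loses $k =
    q^3 \le (2C_1)^4/q$. *)
Lemma bkg_bound : exists2 C : R, 0 <= C &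
  forall (T : finType) (f : T -> int) (k g n : nat) (A : set int) (q : R),
  injective f -> (forall t, 1 <= f t <= n%:Z) -> (0 < #|T|)%N -> (0 < n)%N ->
  (0 < k)%N -> 0 < q -> q ^+ 3 = k%:R -> (forall t, A (f t)) -> is_Bkg k g A ->
  #|T|%:R ^+ k <= Num.sqrt (pi * k%:R / 2) * k`!%:R * g%:R * (1 + C / q) * n%:R.
Proof.
have [C1 C1ge KC] := @kernel_estimate_exists R.
have p0 : 0 <= (2 * C1) ^+ 4 by rewrite exprn_ge0//; lra.
exists (2 * C1 + (2 * C1) ^+ 4); first lra.
move=> T f k g n A q fi fr T0 n0 k0 q0 qk fA Bk.
have s1 := sqrt_pi_half_ge1 k0; set s := Num.sqrt _ in s1 *.
have qi0 : 0 < q^-1 by rewrite invr_gt0.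
have F0 : 0 <= k`!%:R * g%:R * n%:R :> R by rewrite !mulr_ge0.
have Z0 : 0 <= #|T|%:R ^+ k :> R by rewrite exprn_ge0.
have [qC|qC] := leP (2 * C1) q.
  have q1 : 1 <= q by lra.
  have Cq : C1 <= q by lra.
  have D := bkg_density_bound fi fr T0 qk q1 KC Cq fA Bk.
  have z01 : 0 <= C1 / q <= 2^-1.
    by rewrite divr_ge0 ?(ltW q0)//=; [rewrite ler_pdivrMr//; lra|lra].
  apply: le_trans (le_of_mul_sub Z0 z01 D) _.
  have -> : k`!%:R * g%:R * (n%:R * s) * (1 + 2 * (C1 / q)) =
     k`!%:R * g%:R * n%:R * s * (1 + 2 * C1 / q) by ring.
  have -> : s * k`!%:R * g%:R * (1 + (2 * C1 + (2 * C1) ^+ 4) / q) * n%:R =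
     k`!%:R * g%:R * n%:R * s * (1 + (2 * C1 + (2 * C1) ^+ 4) / q) by ring.
  apply: ler_wpM2l; first by apply: mulr_ge0 => //; lra.
  by rewrite lerD2l ler_wpM2r ?(ltW qi0)//; lra.
apply: le_trans (bkg_crude_bound fi fr k0 n0 fA Bk) _; rewrite natrM.
have -> : k`!%:R * g%:R * (k%:R * n%:R) = k`!%:R * g%:R * n%:R * k%:R :> R by ring.
have -> : s * k`!%:R * g%:R * (1 + (2 * C1 + (2 * C1) ^+ 4) / q) * n%:R =
     k`!%:R * g%:R * n%:R * (s * (1 + (2 * C1 + (2 * C1) ^+ 4) / q)) by ring.
apply: ler_wpM2l => //; apply: (@le_trans _ _ (1 * ((2 * C1) ^+ 4 / q))).
  rewrite mul1r -qk ler_pdivlMr// -exprSr.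
  by rewrite lerXn2r ?nnegrE ?(ltW q0) ?(ltW qC)//; lra.
apply: ler_pM => //; first by rewrite divr_ge0// ltW.
have -> : (2 * C1 + (2 * C1) ^+ 4) / q = 2 * C1 / q + (2 * C1) ^+ 4 / q by ring.
have : 0 <= 2 * C1 / q by apply: divr_ge0; [lra|exact: ltW].
lra.
Qed.

Lemma fact_shift3 (k a : nat) : (12 <= k)%N -> (k <= 2 * a.+3 + 1)%N ->
  k%:R ^+ 3 * a`!%:R <= 4 ^+ 3 * a.+3`!%:R :> R.
Proof.
move=> k12 ka; rewrite -!natrX -!natrM ler_nat !factS !mulnA leq_mul2r.
apply/orP; right; have h : (k <= 4 * a.+1)%N by lia.
apply: (@leq_trans ((4 * a.+1) ^ 3)); first by rewrite leq_exp2r.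
have -> : (4 ^ 3 * a.+3 * a.+2 * a.+1 = 4 ^ 3 * (a.+3 * (a.+2 * a.+1)))%N by rewrite !mulnA.
rewrite expnMn leq_mul2l; apply/orP; right.
by rewrite !expnS expn0 muln1; do 2!(apply: leq_mul; first lia).
Qed.

Lemma halves_shift3 (k : nat) : (12 <= k)%N -> exists a b : nat,
  [/\ uphalf k = a.+3, k./2 = b.+3, a = b \/ a = b.+1, k = (a.+3 + b.+3)%N &
      (k <= 2 * a.+3 + 1)%N /\ (k <= 2 * b.+3 + 1)%N].
Proof.
move=> k12; exists (uphalf k - 3)%N, (k./2 - 3)%N.
have := odd_double_half k; have := uphalf_half k.
by move: (uphalf k) (k./2) => u h; case: (odd k) => /= *; split; lia.
Qed.

(** The tripled estimate bounds $|T|^{k-4}$ by a constant times $a!\,b!\,kn$, and three factorial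
    steps on each side are worth $k^6$. Restoring $|T|^4$ leaves a factor of order $|T|^4/k^5$,
    which the last hypothesis makes at most $\sqrt k$. *)
Lemma sidon_small_bound : exists2 K : R, 1 <= K &
  forall (T : finType) (f : T -> int) (k n : nat) (A : set int),
  injective f -> (forall t, 1 <= f t <= n%:Z) -> (0 < n)%N -> (1024 <= k)%N ->
  (k <= 8 * #|T|)%N -> (forall t, A (f t)) -> is_Bkg k 1 A ->
  K ^+ 2 * #|T|%:R ^+ 8 <= k%:R ^+ 11 ->
  #|T|%:R ^+ k <= (uphalf k)`!%:R * k./2`!%:R * Num.sqrt (k%:R : R) * n%:R.
Proof.
set E : R := expR (- (64 * 4)) / 4.
have E0 : 0 < E by rewrite divr_gt0 ?expR_gt0.
exists (1 + 16 * 4 ^+ 6 / E).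
  by rewrite lerDl divr_ge0 ?mulr_ge0 ?exprn_ge0 ?(ltW E0).
move=> T f k n A fi fr n0 k1 kN fA Bk KN; set N : R := #|T|%:R in KN *.
have k12 : (12 <= k)%N by apply: leq_trans k1; rewrite -subn_eq0.
have [a [b [ka kb ab abk [ha hb]]]] := halves_shift3 k12.
rewrite ka kb; have Bk' : is_Bkg (a.+3 + b.+3) 1 A by rewrite -abk.
have N128 : 128 <= N by rewrite /N ler_nat; lia.
have bN : b.+1%:R <= 4 * N by rewrite /N -natrM ler_nat; lia.
have N0 : 0 <= N by [].
have U := @sidon_tripled_bound R T f n fi fr a b A fA Bk' n0.
have L := sum_tripled_lb ab N128 bN.
have two0 : 0 < 2 ^+ #|T| :> R by rewrite exprn_gt0.
have := le_trans L U; rewrite (ler_pM2l two0) -/N -/E -abk => {L U} M.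
have k0 : 0 < k%:R :> R by rewrite ltr0n; lia.
have Fa : k%:R ^+ 3 * a`!%:R <= 4 ^+ 3 * a.+3`!%:R :> R by apply: fact_shift3.
have Fb : k%:R ^+ 3 * b`!%:R <= 4 ^+ 3 * b.+3`!%:R :> R by apply: fact_shift3.
have Fab : k%:R ^+ 6 * (a`!%:R * b`!%:R) <= 4 ^+ 6 * (a.+3`!%:R * b.+3`!%:R) :> R.
  have -> : k%:R ^+ 6 * (a`!%:R * b`!%:R) = (k%:R ^+ 3 * a`!%:R) * (k%:R ^+ 3 * b`!%:R) :> R by ring.
  have -> : 4 ^+ 6 * (a.+3`!%:R * b.+3`!%:R) = (4 ^+ 3 * a.+3`!%:R) * (4 ^+ 3 * b.+3`!%:R) :> R by ring.
  by apply: ler_pM => //; rewrite mulr_ge0 ?exprn_ge0 ?(ltW k0).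
rewrite abk in k0 *; rewrite abk in KN Fab; rewrite -abk in KN Fab k0 M *.
set G : R := a`!%:R * b`!%:R in M Fab; set H : R := a.+3`!%:R * b.+3`!%:R in Fab *.
have KN4 : (1 + 16 * 4 ^+ 6 / E) * N ^+ 4 <= k%:R ^+ 5 * Num.sqrt k%:R.
  rewrite -(@ler_pXn2r _ 2) ?nnegrE ?mulr_ge0 ?exprn_ge0 ?(ltW k0) ?sqrtr_ge0//; last first.
    by rewrite addr_ge0// divr_ge0 ?mulr_ge0 ?exprn_ge0 ?(ltW E0).
  rewrite [leRHS]exprMn sqr_sqrtr ?(ltW k0)// -exprM -exprSr.
  by rewrite exprMn -exprM.
have KN4' : 16 * 4 ^+ 6 * N ^+ 4 <= E * (k%:R ^+ 5 * Num.sqrt k%:R).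
  have N40 : 0 <= N ^+ 4 by rewrite exprn_ge0.
  have e : E * (16 * 4 ^+ 6 / E * N ^+ 4) = 16 * 4 ^+ 6 * N ^+ 4 by field; rewrite gt_eqF.
  by rewrite -e; apply: ler_wpM2l (ltW E0) _ _ _; lra.
have c0 : 0 < E * k%:R ^+ 5 by rewrite mulr_gt0// exprn_gt0.
rewrite -(ler_pM2l c0).
have -> : N ^+ k = N ^+ (a + b).+2 * N ^+ 4.
  by rewrite -exprD; congr (_ ^+ _); rewrite abk; clear; lia.
have -> : E * k%:R ^+ 5 * (N ^+ (a + b).+2 * N ^+ 4) =
  k%:R ^+ 5 * N ^+ 4 * (N ^+ (a + b).+2 * E) by ring.
have N4k : 0 <= k%:R ^+ 5 * N ^+ 4 by rewrite mulr_ge0 ?exprn_ge0 ?(ltW k0).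
apply: le_trans (ler_wpM2l N4k M) _; rewrite natrM.
have -> : k%:R ^+ 5 * N ^+ 4 * (16 * G * (k%:R * n%:R)) =
  16 * N ^+ 4 * n%:R * (k%:R ^+ 6 * G) by ring.
have h0 : 0 <= 16 * N ^+ 4 * n%:R by rewrite !mulr_ge0 ?exprn_ge0.
apply: le_trans (ler_wpM2l h0 Fab) _.
have -> : 16 * N ^+ 4 * n%:R * (4 ^+ 6 * H) = H * n%:R * (16 * 4 ^+ 6 * N ^+ 4) by ring.
have -> : E * k%:R ^+ 5 * (H * Num.sqrt k%:R * n%:R) =
  H * n%:R * (E * (k%:R ^+ 5 * Num.sqrt k%:R)) by ring.
by apply: ler_wpM2l KN4'; rewrite !mulr_ge0.
Qed.

Lemma fact_mul_small (k N : nat) : (8 * N < k)%N -> (N ^ k <= (uphalf k)`! * (k./2)`!)%N.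
Proof.
move=> Nk; have h1 : (k./2 + uphalf k = k)%N.
  by rewrite uphalf_half addnCA addnn odd_double_half.
rewrite -{1}h1 addnC expnD; apply: leq_mul; apply: expr_le_fact.
  by rewrite uphalf_half in h1 *; lia.
by rewrite uphalf_half in h1 *; lia.
Qed.

(** With [x] equal to [N * q^-1 ^+ 4 / 512], the lower bound on $|T|^8$ gives $x^8$ at least a
    constant times $q^{33}/q^{32} = q$. The probability of an unbalanced splitting is thus
    $O(1/q)$. *)
Lemma sidon_large_bound (K : R) : 1 <= K -> exists2 C : R, 1 <= C &
  forall (T : finType) (f : T -> int) (k n : nat) (A : set int) (q : R),
  injective f -> (forall t, 1 <= f t <= n%:Z) -> (0 < #|T|)%N ->
  q ^+ 3 = k%:R -> 2 * C <= q -> (forall t, A (f t)) -> is_Bkg k 1 A ->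
  k%:R ^+ 11 <= K ^+ 2 * #|T|%:R ^+ 8 ->
  #|T|%:R ^+ k <= (uphalf k)`!%:R * k./2`!%:R * (n%:R * Num.sqrt (pi * k%:R / 2)) *
    (1 + 2 * (C / q)).
Proof.
move=> K1; have [C1 C1ge KC] := @kernel_estimate_exists R.
have [D8 D80] : exists2 D8 : R, 0 <= D8 & forall x : R, 0 < x -> expR (- x) <= D8 / x ^+ 8.
  by exists 8`!%:R; [exact: ler0n|exact: expRN_le_inv8].
have [L [L0 LE]] : exists L : R, 0 < L /\ L = 512 by exists 512; rewrite ltr0n.
move=> Dle; set C3 := 4 * D8 * K ^+ 2 * L ^+ 8.
have C30 : 0 <= C3 by rewrite !mulr_ge0 ?exprn_ge0 ?(ltW L0)//; lra.
exists (1 + C3 + C1); first lra.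
move=> T f k n A q fi fr T0 qk qC fA Bk KN; set N : R := #|T|%:R in KN *.
have q1 : 1 <= q by lra.
have q0 : 0 < q by lra.
have w0 : 0 < q^-1 by rewrite invr_gt0.
have N0 : 0 < N by rewrite ltr0n.
have ab : (uphalf k = k./2 \/ uphalf k = (k./2).+1) /\ (uphalf k + k./2)%N = k.
  rewrite uphalf_half -addnA addnn odd_double_half; split => //.
  by case: (odd k); [right|left].
have Cq : C1 <= q by lra.
have D := sidon_density_bound fi fr T0 qk q1 ab fA Bk KC Cq.
rewrite -/N in D; set Y := _ * _ * (n%:R * _) in D *.
have tail : 4 * expR (- (N * q^-1 ^+ 4 / 512)) <= C3 * q^-1.
  rewrite -LE; set x := N * q^-1 ^+ 4 / L.
  have x0 : 0 < x by rewrite divr_gt0// mulr_gt0// exprn_gt0.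
  have -> : C3 * q^-1 = 4 * (D8 * (K ^+ 2 * L ^+ 8 * q^-1)) by rewrite /C3; ring.
  apply: ler_wpM2l => //; apply: le_trans (Dle x x0) _.
  apply: ler_wpM2l => //; rewrite -[leRHS]invrK lef_pV2 ?posrE ?exprn_gt0//; last first.
    by rewrite invr_gt0 !mulr_gt0 ?exprn_gt0//; lra.
  have -> : (K ^+ 2 * L ^+ 8 * q^-1)^-1 = q / (K ^+ 2 * L ^+ 8).
    by field; rewrite !gt_eqF//; lra.
  have -> : x ^+ 8 = (K ^+ 2 * N ^+ 8) / q ^+ 32 / (K ^+ 2 * L ^+ 8).
    by rewrite /x; field; rewrite !gt_eqF//; lra.
  have c0 : 0 <= (K ^+ 2 * L ^+ 8)^-1.
    by rewrite invr_ge0 mulr_ge0 ?exprn_ge0 ?(ltW L0)//; lra.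
  apply: ler_wpM2r => //; rewrite ler_pdivlMr ?exprn_gt0// -exprS.
  by apply: le_trans KN; rewrite -qk -exprM.
have c1 : (1 + C3 + C1) * q^-1 <= 2^-1.
  by rewrite -[_ * q^-1]/(_ / q) ler_pdivrMr//; lra.
set z := (1 + C3 + C1) / q; have z0 : 0 <= z by rewrite mulr_ge0 ?(ltW w0)//; lra.
have zz : 0 <= z <= 2^-1 by rewrite z0 c1.
have Nk : 0 <= N ^+ k by rewrite exprn_ge0// ltW.
set e1 := expR (- q^-1) in D; set e2 := 4 * expR _ in D tail.
apply: (le_of_mul_sub Nk zz); apply: le_trans D.
have -> : N ^+ k * e1 * (1 - e2) * (1 - C1 / q) = N ^+ k * (e1 * (1 - e2) * (1 - C1 / q)) by ring.
apply: ler_wpM2l => //.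
have e1lb : 1 - q^-1 <= e1 by have := expR_ge1Dx (- q^-1); rewrite /e1; lra.
have e20 : 0 <= e2 by rewrite mulr_ge0 ?expR_ge0.
have C3w : 0 <= C3 * q^-1 by rewrite mulr_ge0 ?(ltW w0).
have C1w : 0 <= C1 * q^-1 by rewrite mulr_ge0 ?(ltW w0)//; lra.
have zE : z = q^-1 + C3 * q^-1 + C1 * q^-1 by rewrite /z; ring.
move: zz; rewrite zE => /andP[_ zz].
have p1 : (1 - q^-1) * (1 - C3 * q^-1) <= e1 * (1 - e2).
  by apply: ler_pM; lra.
have p2 : (1 - q^-1) * (1 - C3 * q^-1) * (1 - C1 * q^-1) <= e1 * (1 - e2) * (1 - C1 * q^-1).
  by apply: ler_wpM2r => //; lra.
apply: le_trans p2.
move: (q^-1) (C3 * q^-1) (C1 * q^-1) w0 C3w C1w zz => x1 x2 x3 x10 x20 x30 xx.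
have := mulr_ge0 (mulr_ge0 (ltW x10) x20) (_ : 0 <= 1 - x3).
have := mulr_ge0 (ltW x10) x30; have := mulr_ge0 x20 x30.
rewrite subr_ge0 => h1 h2 /(_ ltac:(lra)) h3; lra.
Qed.

Lemma sidon_bound : exists2 C : R, 0 <= C &
  forall (T : finType) (f : T -> int) (k n : nat) (A : set int) (q : R),
  injective f -> (forall t, 1 <= f t <= n%:Z) -> (0 < #|T|)%N -> (0 < n)%N ->
  (0 < k)%N -> 0 < q -> q ^+ 3 = k%:R -> (forall t, A (f t)) -> is_Bkg k 1 A ->
  #|T|%:R ^+ k <= (uphalf k)`!%:R * k./2`!%:R * Num.sqrt (pi * k%:R / 2) *
     (1 + C / q) * n%:R.
Proof.
have [K K1 small] := sidon_small_bound.
have [C C1 large] := sidon_large_bound K1.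
pose Q := 2 * C + 16; have Q0 : 0 < Q by rewrite /Q; lra.
pose m := (Num.truncn (Q ^+ 3)).+1.
have mQ : Q ^+ 3 < m%:R.
  by have /andP[] := truncn_itv (exprn_ge0 3 (ltW Q0)).
have F0 : 0 <= m`!%:R * m%:R * Q :> R by rewrite !mulr_ge0// ltW.
exists (2 * C + m`!%:R * m%:R * Q); first lra.
move=> T f k n A q fi fr T0 n0 k0 q0 qk fA Bk.
have s1 := sqrt_pi_half_ge1 k0; have s2 := sqrt_pi_half_ge k.
set s := Num.sqrt (pi * _ / 2) in s1 s2 *.
set H : R := (uphalf k)`!%:R * k./2`!%:R.
have H1 : 1 <= H by rewrite /H -natrM ler1n muln_gt0 !fact_gt0.
have n1 : 1 <= n%:R :> R by rewrite ler1n.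
set Z := (2 * C + _) / q; have Z0 : 0 <= Z by rewrite divr_ge0 ?(ltW q0)//; lra.
have H0 : 0 <= H by lra.
have Hs0 : 0 <= H * s by rewrite mulr_ge0//; lra.
have qi0 : 0 < q^-1 by rewrite invr_gt0.
have up (X : R) : 0 <= X -> X <= H * s * n%:R -> X <= H * s * (1 + Z) * n%:R.
  move=> X0 h; apply: le_trans h _; apply: ler_wpM2r => //.
  by apply: ler_peMr => //; rewrite lerDl.
have N0 : 0 <= #|T|%:R ^+ k :> R by rewrite exprn_ge0.
have [qQ|qQ] := ltP q Q.
  apply: le_trans (bkg_crude_bound fi fr k0 n0 fA Bk) _.
  have km : (k <= m)%N.
    rewrite -(ler_nat R) -qk ltW//; apply: le_lt_trans mQ.
    by rewrite lerXn2r ?nnegrE ?(ltW q0) ?(ltW Q0)// ltW.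
  rewrite mulr1 natrM mulrA; apply: ler_wpM2r => //.
  apply: (@le_trans _ _ (m`!%:R * m%:R)).
    rewrite -!natrM ler_nat leq_mul//; exact: leq_fact.
  have e : m`!%:R * m%:R <= Z.
    rewrite /Z ler_pdivlMr//; apply: (@le_trans _ _ (m`!%:R * m%:R * Q)).
      by rewrite ler_wpM2l ?mulr_ge0// ltW.
    lra.
  apply: (@le_trans _ _ (1 + Z)); first lra.
  by apply: ler_peMl; [lra|exact: mulr_ege1].
have [Nk|kN] := ltnP (8 * #|T|) k.
  apply: up => //; apply: (@le_trans _ _ (H * 1 * 1)).
    by rewrite !mulr1 /H -natrM -natrX ler_nat; exact: fact_mul_small.
  by apply: ler_pM => //; rewrite ?mulr1// ler_peMr.
have [KN|KN] := leP (K ^+ 2 * #|T|%:R ^+ 8) (k%:R ^+ 11).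
  have k1024 : (1024 <= k)%N.
    rewrite -(ler_nat R) -qk; apply: (@le_trans _ _ (16 ^+ 3)).
      by rewrite -natrX ler_nat.
    by rewrite lerXn2r ?nnegrE ?(ltW q0)//; rewrite /Q in qQ; lra.
  apply: up => //; apply: le_trans (small T f k n A fi fr n0 k1024 kN fA Bk KN) _.
  by apply: ler_wpM2r => //; apply: ler_wpM2l.
have q2C : 2 * C <= q by rewrite /Q in qQ; lra.
apply: le_trans (large T f k n A q fi fr T0 qk q2C fA Bk (ltW KN)) _.
rewrite -/H -/s.
have -> : H * (n%:R * s) * (1 + 2 * (C / q)) = H * s * (1 + 2 * C / q) * n%:R by ring.
apply: ler_wpM2r => //; apply: ler_wpM2l => //; rewrite lerD2l /Z.
by apply: ler_wpM2r; [exact: ltW|lra].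
Qed.

End Assembly.

(** * Passage to $k$-th roots and to finite sets of integers *)

Lemma root_bound (R : realType) (k : nat) (x Y : R) : (0 < k)%N -> 0 <= x ->
  x ^+ k <= Y -> x <= Y `^ (1 / k%:R).
Proof.
move=> k0 x0 xY; have kR : k%:R != 0 :> R by rewrite pnatr_eq0 -lt0n.
have {1}-> : x = (x ^+ k) `^ (1 / k%:R).
  by rewrite -powR_mulrn// -powRrM mulrA mulr1 divff// powRr1.
have xk : 0 <= x ^+ k by rewrite exprn_ge0.
by apply: ge0_ler_powR; rewrite ?nnegrE ?divr_ge0// (le_trans xk).
Qed.

Theorem theorem1p1 (R : realType) :
  exists C : R,
    forall (k g n : nat) (A : {fset int}),
      (2 <= k)%N -> (1 <= g)%N -> (1 <= n)%N ->
      (forall a : int, a \in A -> 1 <= a <= n%:Z) ->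
      is_Bkg k g [set` A] ->
      (g = 1%N ->
        exists2 e : R, `|e| <= C * k%:R `^ (- (1 / 3)) &
          #|` A|%:R <=
            ((uphalf k)`!%:R * (k./2)`!%:R * Num.sqrt (pi * k%:R / 2)
               * (1 + e) * n%:R) `^ (1 / k%:R)) /\
      ((1 < g)%N ->
        exists2 e : R, `|e| <= C * k%:R `^ (- (1 / 3)) &
          #|` A|%:R <=
            (Num.sqrt (pi * k%:R / 2) * k`!%:R * g%:R
               * (1 + e) * n%:R) `^ (1 / k%:R)).
Proof.
have [C1 C10 sidon] := @sidon_bound R; have [C2 C20 bkg] := @bkg_bound R.
exists (C1 + C2) => k g n A k2 g1 n1 Arange Bkg.
have k0 : (0 < k)%N by exact: leq_trans k2.
have kR : 0 < k%:R :> R by rewrite ltr0n.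
set w := k%:R `^ (- (1 / 3)).
pose q : R := k%:R `^ (1 / 3).
have q0 : 0 < q by rewrite powR_gt0.
have wq : w = q^-1 by rewrite /w powRN.
have qk : q ^+ 3 = k%:R.
  rewrite -powR_mulrn ?powR_ge0// /q -powRrM -[RHS]powRr1//.
  by congr powR; field.
have w0 : 0 <= w by rewrite wq invr_ge0 ltW.
have e0 : 0 <= (C1 + C2) * w by rewrite mulr_ge0// addr_ge0.
have s0 : 0 <= Num.sqrt (pi * k%:R / 2) :> R by exact: sqrtr_ge0.
(* The empty set is treated apart, since the estimates centre at the mean of the set. *)
have [A0|Apos] := posnP #|` A|.
  by split=> _; exists ((C1 + C2) * w); rewrite ?ger0_norm// A0 powR_ge0.
rewrite cardfE in Apos *.
have fr (t : A) : 1 <= (val t : int) <= n%:Z by apply: Arange; exact: valP.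
have fA (t : A) : [set` A] (val t) by exact: valP.
have X0 (c : R) : 0 <= c -> 0 <= 1 + c * w by move=> c0; rewrite addr_ge0// mulr_ge0.
split=> [g1E|_]; exists ((C1 + C2) * w); rewrite ?ger0_norm//; apply: root_bound => //.
  rewrite g1E in Bkg.
  apply: le_trans (sidon A val k n [set` A] q val_inj fr Apos n1 k0 q0 qk fA Bkg) _.
  apply: ler_wpM2r => //; apply: ler_wpM2l; first by rewrite !mulr_ge0.
  by rewrite lerD2l -wq ler_wpM2r// lerDl.
apply: le_trans (bkg A val k g n [set` A] q val_inj fr Apos n1 k0 q0 qk fA Bkg) _.
apply: ler_wpM2r => //; apply: ler_wpM2l; first by rewrite !mulr_ge0.
by rewrite lerD2l -wq ler_wpM2r// lerDr.
Qed.
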